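(* Let $(p,q)\in\mathbb Y$, where $$\mathbb Y:=\left\{(p,q)\in(0,1)\times(0,1):\ \max\{\tau_{1,2}(p,q),\tau_{2,1}(p,q)\}<\tau(p,q)^{3/2}\right\}.$$ Let $X_n,Y_n$ be two independent random graphs with laws $G(n,p)$, $G(n,q)$, respectively. Let $(C_n)$ be a sequence with $C_n\to\infty$ and $C_n/\log n\to0$. Then: (I) if $m(n)=\lfloor m_*(n)-(C_n/\log n)\rfloor$, then $\lim_{n\to\infty}\mathbb P\big(X_n\stackrel{m(n)}{\cong}Y_n\big)=1$; (II) if $m(n)=\lceil m_*(n)+(C_n/\log n)\rceil$, then $\lim_{n\to\infty}\mathbb P\big(X_n\stackrel{m(n)}{\cong}Y_n\big)=0$.
   Context: $G(n,p)$ is the law of the Erdős–Rényi random undirected simple graph on $n$ vertices in which each potential edge is present with probability $p$, independently. Two graphs $\Gamma,\Gamma'$ are $m$-isomorphic, written $\Gamma\stackrel{m}{\cong}\Gamma'$, if there are induced subgraphs $\Delta$ of $\Gamma$ and $\Delta'$ of $\Gamma'$, both with exactly $m$ vertices, such that $\Delta$ and $\Delta'$ are isomorphic. For $p,q\in(0,1)$ put $\tau_{j,k}=\tau_{j,k}(p,q):=p^jq^k+(1-p)^j(1-q)^k$, $\tau:=\tau_{1,1}$, $\lambda:=1/\log(1/\tau)$. Let $W(x):=x+2\lambda\log x+\frac{\lambda}{x}\log(2\pi x)$ for $x\ge1$; this function is strictly increasing with $W(x)\to\infty$. The number $m_*(n)\ge 1$ is defined (uniquely) by $W(m_*(n))=4\lambda\log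 n+2\lambda+1$. $\log$ is the natural logarithm. *)

(* Defs.v *)
From HB Require Import structures.
From mathcomp Require Import all_boot all_order all_algebra.
From mathcomp Require Import all_classical all_reals all_analysis.

Set Implicit Arguments.
Unset Strict Implicit.
Unset Printing Implicit Defensive.

Import Order.TTheory GRing.Theory Num.Theory.
Import numFieldNormedType.Exports.

Local Open Scope classical_set_scope.

(* A simple graph is given by its set of edges, which are unordered pairs of
   distinct vertices; Leibniz equality is thus equality of edge sets. *)
Record sgraph (V : finType) := SGraph {
  edges : {set {set V}};
  edges_card2 : [forall e in edges, #|e| == 2] }.

Definition adj (V : finType) (g : sgraph V) (x y : V) : bool :=
  [set x; y]%SET \in edges g.

Definition isomorphic (V W : finType) (g : sgraph V) (h : sgraph W) : Prop :=
  exists f : V -> W, bijective f /\ forall x y, adj g x y = adj h (f x) (f y).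

Section Induced.
Variables (V : finType) (g : sgraph V) (A : {set V}).

Definition induced_edges : {set {set {x : V | x \in A}}} :=
  [set e : {set {x : V | x \in A}} | [set val x | x in e]%SET \in edges g]%SET.

Lemma induced_edges_card2 : [forall e in induced_edges, #|e| == 2].
Proof.
apply/forall_inP => e; rewrite inE => eg.
by rewrite -(card_imset _ val_inj); apply: (forall_inP (edges_card2 g)).
Qed.

Definition induced : sgraph {x : V | x \in A} := SGraph induced_edges_card2.

End Induced.

Definition m_isomorphic (V W : finType) (m : nat)
    (g : sgraph V) (h : sgraph W) : Prop :=
  exists (A : {set V}) (B : {set W}),
    [/\ #|A| = m, #|B| = m & isomorphic (induced g A) (induced h B)].

Local Open Scope ring_scope.

(* Mass given to [g] when each of the potential edges is independently present
   with probability [p]. *)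
Definition gnp_pmf (R : realType) (n : nat) (p : R) (g : sgraph 'I_n) : R :=
  \prod_(e : {set 'I_n} | #|e| == 2%N) (if e \in edges g then p else 1 - p).

(* Random elements of the finite set of graphs, for its discrete
   sigma-algebra. *)
Definition random_graph d (T : measurableType d) (n : nat)
    (X : T -> sgraph 'I_n) : Prop :=
  forall S : set (sgraph 'I_n), measurable (X @^-1` S).

Definition has_law_gnp (R : realType) d (T : measurableType d)
    (P : probability T R) (n : nat) (p : R) (X : T -> sgraph 'I_n) : Prop :=
  random_graph X /\
  forall g : sgraph 'I_n, P (X @^-1` [set g]) = (gnp_pmf p g)%:E.

Definition independent_graphs (R : realType) d (T : measurableType d)
    (P : probability T R) (n : nat) (X Y : T -> sgraph 'I_n) : Prop :=
  forall S S' : set (sgraph 'I_n),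
    P (X @^-1` S `&` Y @^-1` S') = (P (X @^-1` S) * P (Y @^-1` S'))%E.

Definition tau_ (R : realType) (j k : nat) (p q : R) : R :=
  p ^+ j * q ^+ k + (1 - p) ^+ j * (1 - q) ^+ k.

Definition tau (R : realType) (p q : R) : R := tau_ 1 1 p q.

Definition lambda (R : realType) (p q : R) : R := 1 / ln (1 / tau p q).

Definition regionY (R : realType) : set (R * R) :=
  [set pq | [/\ 0 < pq.1 < 1, 0 < pq.2 < 1 &
     Num.max (tau_ 1 2 pq.1 pq.2) (tau_ 2 1 pq.1 pq.2)
       < tau pq.1 pq.2 `^ (3 / 2)]].

Definition Wfun (R : realType) (p q x : R) : R :=
  x + 2 * lambda p q * ln x + lambda p q / x * ln (2 * pi * x).

(* [W] is strictly increasing on [1, +oo[, and [W 1] is below the right-hand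
   side for every [n >= 1], so for those [n] the element picked by [get] is the
   unique solution. *)
Definition m_star (R : realType) (p q : R) (n : nat) : R :=
  get [set x : R | 1 <= x /\
    Wfun p q x = 4 * lambda p q * ln n%:R + 2 * lambda p q + 1].

(* Main.v *)
Require Import Defs.
From HB Require Import structures.
From mathcomp Require Import all_boot all_order all_algebra.
From mathcomp Require Import fingroup perm.
From mathcomp Require Import zify ring lra.

(* Let N count the pairs (a, b) of injections of 'I_m into 'I_n such that a
   pulls X back to the same graph on 'I_m as b pulls Y back.  Every matching
   gives m! such pairs, so P(N > 0) <= E[N] / m!, and by Stirling's formula the
   logarithm of this ratio is (m / (2 lambda)) (W(m_star) - W(m)) + O(1); this
   gives (II), and shows that E[N] / m! tends to infinity in (I).

   For (I) use the second moment.  Two pairs (a, b) and (a', b') of injections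
   define a bipartite graph between the potential edges of X and those of Y,
   and both are counted iff the indicator variables agree along its links.  Its
   components are paths and cycles, of probability tau_{j,k} with |j - k| <= 1,
   and the choice of (p, q) makes tau_{j,k} <= (sqrt(tau) rho)^(j+k) for some
   rho < 1 as soon as j + k >= 3.  So a doubly covered potential edge costs a
   factor rho unless its two partners coincide.  If f is the number of points
   at which the two partial bijections b a^-1 and b' a'^-1 coincide, the terms
   of E[N^2] / E[N]^2 with 0 < f <= delta m / 2 are negligible because the
   overlap is rare, those with delta m / 2 < f < m because of the powers of rho,
   and f = m contributes m! / E[N]. *)

Set Implicit Arguments.
Unset Strict Implicit.
Unset Printing Implicit Defensive.

Import Order.TTheory GRing.Theory Num.Theory.

Local Open Scope ring_scope.

(** * Product measures on bits *)

(** The obstacle in the second moment is that overlaps in X and overlaps in Y interact. Giving each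
    potential edge its own factor, according to its degree in the link graph, turns the joint
    probability into a product of two one-sided bounds. On a side with k overlapping points, the
    gain beyond that of the f fixed points is then at most u^(2(C(k,2) - C(f,2))) / rho^(k - f),
    where r = sqrt(tau) and u^2 = rho / r. Majorizing this by y(f)^(k - f), with y(f) independent of
    k, makes the weight multiplicative over points, so that the sum over all second pairs is
    controlled by (n + m y(f))^(2(m - f)).

    With K = log(1/tau) and rho = tau^(delta/2), y(f) has order exp((1 - delta) K (m + f) / 4),
    whereas n is exp(K m / 4) up to a polynomial factor. Hence m y(f) / n is exponentially small for
    f <= delta m / 2, which is the origin of this cutoff; with delta = 0 it would not tend to 0 even
    at f = 0. Beyond the cutoff the terms are compared with the one at f = m instead. *)

Section ProductMeasure.
Variables (R : realFieldType) (Z : finType) (w : Z -> bool -> R).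
Hypothesis w_ge0 : forall z b, 0 <= w z b.
Hypothesis w_sum1 : forall z, w z true + w z false = 1.

Implicit Types (x : {ffun Z -> bool}) (C : {set Z}).

Definition wt x : R := \prod_z w z (x z).
Definition expect (F : {ffun Z -> bool} -> R) : R := \sum_x wt x * F x.
Definition prob (Q : pred {ffun Z -> bool}) : R := expect (fun x => (Q x)%:R).

Lemma wt_ge0 x : 0 <= wt x.
Proof. exact: prodr_ge0. Qed.

Lemma sum_bool (F : bool -> R) : \sum_b F b = F true + F false.
Proof. by rewrite big_bool. Qed.

Lemma expect1 : expect (fun=> 1) = 1.
Proof.
rewrite /expect; under eq_bigr do rewrite mulr1.
by rewrite -(bigA_distr_bigA w) big1 // => z _; rewrite sum_bool.
Qed.

Lemma expect_le F G : (forall x, F x <= G x) -> expect F <= expect G.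
Proof. by move=> le; apply: ler_sum => x _; rewrite ler_wpM2l ?wt_ge0. Qed.

Lemma prob_le (Q Q' : pred _) : (forall x, Q x -> Q' x) -> prob Q <= prob Q'.
Proof.
by move=> h; apply: expect_le => x; rewrite ler_nat; case: (Q x) (h x) => // ->.
Qed.

Lemma eq_prob (Q Q' : pred _) : Q =1 Q' -> prob Q = prob Q'.
Proof. by move=> h; apply: eq_bigr => x _; rewrite h. Qed.

Lemma prob_ge0 Q : 0 <= prob Q.
Proof. by apply: sumr_ge0 => x _; rewrite mulr_ge0 ?wt_ge0 ?ler0n. Qed.

Lemma probC Q : prob (fun x => ~~ Q x) = 1 - prob Q.
Proof.
rewrite -expect1 /prob /expect -sumrB; apply: eq_bigr => x _.
by rewrite -mulrBr; case: (Q x); rewrite /= ?subrr ?subr0.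
Qed.

Lemma expect_sum (I : Type) (s : seq I) (Q : pred I) F :
  expect (fun x => \sum_(i <- s | Q i) F i x) = \sum_(i <- s | Q i) expect (F i).
Proof.
by rewrite /expect exchange_big; apply: eq_bigr => x _ /=; rewrite mulr_sumr.
Qed.

(* Resampling: swapping, between two independent samples, the coordinates
   outside of [C] is a measure-preserving involution. *)
Lemma expect_indep C (F G : {ffun Z -> bool} -> R) :
    (forall x x', {in C, x =1 x'} -> F x = F x') ->
    (forall x x', {in ~: C, x =1 x'} -> G x = G x') ->
  expect (fun x => F x * G x) = expect F * expect G.
Proof.
move=> FC GC.
pose mix x x' : {ffun Z -> bool} := [ffun z => if z \in C then x z else x' z].
pose sw (u : {ffun Z -> bool} * {ffun Z -> bool}) := (mix u.1 u.2, mix u.2 u.1).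
have swK : involutive sw.
  move=> [x x']; congr pair; apply/ffunP => z; rewrite !ffunE /=;
  by do 2?[rewrite ffunE /=|case: ifP => //].
(* The factor 1, read as [expect1], supplies the second independent sample. *)
rewrite -[LHS]mulr1 -expect1 /expect !big_distrlr /= !pair_bigA /=.
rewrite [RHS](reindex_inj (inv_inj swK)); apply: eq_bigr => -[x x'] _ /=.
have -> : F (mix x x') = F x by apply: FC => z zC; rewrite ffunE zC.
have -> : G (mix x' x) = G x.
  by apply: GC => z; rewrite inE ffunE => /negPf ->.
have -> : wt (mix x x') * F x * (wt (mix x' x) * G x) =
  wt (mix x x') * wt (mix x' x) * (F x * G x) by ring.
suff -> : wt (mix x x') * wt (mix x' x) = wt x * wt x' by ring.
rewrite /wt -!big_split; apply: eq_bigr => z _ /=; rewrite !ffunE.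
by case: ifP => //; rewrite mulrC.
Qed.

Lemma prob_indep C (Q Q' : pred {ffun Z -> bool}) :
    (forall x x', {in C, x =1 x'} -> Q x = Q x') ->
    (forall x x', {in ~: C, x =1 x'} -> Q' x = Q' x') ->
  prob (fun x => Q x && Q' x) = prob Q * prob Q'.
Proof.
move=> QC QC'; rewrite -(@expect_indep C); last 2 first.
- by move=> x x' /QC ->.
- by move=> x x' /QC' ->.
by apply: eq_bigr => x _; rewrite -natrM mulnb.
Qed.

Lemma prob_cylinder C (y : Z -> bool) :
  prob (fun x : {ffun Z -> bool} => [forall z in C, x z == y z]) = \prod_(z in C) w z (y z).
Proof.
rewrite /prob /expect.
transitivity (\sum_(x : {ffun Z -> bool})
    \prod_z (w z (x z) * ((z \in C) ==> (x z == y z))%:R)).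
  apply: eq_bigr => x _; rewrite big_split /=; congr (_ * _).
  case: (boolP [forall z in C, x z == y z]) => [/forall_inP h|].
    rewrite big1 // => z _; case: (boolP (z \in C)) => //= zC.
    by rewrite h.
  rewrite negb_forall => /existsP[z]; rewrite negb_imply => /andP[zC /negPf xz].
  by rewrite (bigD1 z) //= zC xz mul0r.
rewrite -(bigA_distr_bigA (fun z b => w z b * ((z \in C) ==> (b == y z))%:R)).
rewrite [RHS]big_mkcond; apply: eq_bigr => z _; rewrite sum_bool.
case: ifP => _ /=; last by rewrite !mulr1.
by case: (y z); rewrite /= ?mulr1 ?mulr0 ?addr0 ?add0r.
Qed.

Lemma prob_const C z0 : z0 \in C ->
  prob (fun x : {ffun Z -> bool} => [forall z in C, x z == x z0]) =
  \prod_(z in C) w z true + \prod_(z in C) w z false.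
Proof.
move=> z0C; rewrite -(prob_cylinder C (fun=> true)) -(prob_cylinder C (fun=> false)).
rewrite /prob /expect -big_split; apply: eq_bigr => x _ /=.
rewrite -mulrDr; congr (_ * _).
have E b : [forall z in C, x z == b] = (x z0 == b) && [forall z in C, x z == x z0].
  apply/forall_inP/andP => [h|[/eqP <- /forall_inP //]].
  have h0 := eqP (h _ z0C); split; first by rewrite h0.
  by apply/forall_inP => z zC; rewrite h0; exact: h.
by rewrite (E true) (E false); case: (x z0) => /=; rewrite ?addr0 ?add0r.
Qed.

(** The sets [{f i, g i}] are disjoint, so the constraints are independent and can be split off one
    at a time. *)
Lemma prob_matching (I : finType) (D : {set I}) (f g : I -> Z) (t : R) :
    {in D &, injective f} -> {in D &, injective g} ->
    {in D &, forall i j, f i != g j} ->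
    {in D, forall i, w (f i) true * w (g i) true + w (f i) false * w (g i) false = t} ->
  prob (fun x : {ffun Z -> bool} => [forall i in D, x (f i) == x (g i)]) = t ^+ #|D|.
Proof.
have [n cD] : exists n, #|D| = n by exists #|D|.
rewrite cD; elim: n D cD => [|n IH] D cD fI gI fg tE.
  rewrite expr0 -expect1; apply: eq_bigr => x _; congr (_ * _).
  suff -> : [forall i in D, x (f i) == x (g i)] by [].
  by apply/forall_inP => i; rewrite (cards0_eq cD) inE.
have /card_gt0P[i0 i0D] : (0 < #|D|)%N by rewrite cD.
set D' := D :\ i0.
have cD' : #|D'| = n by move: cD; rewrite (cardsD1 i0) i0D => -[].
have sD : {subset D' <= D} by move=> i; rewrite inE => /andP[].
pose C := [set f i0; g i0].
rewrite (@eq_prob _ (fun x => [forall z in C, x z == x (g i0)] &&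
    [forall i in D', x (f i) == x (g i)])); last first.
  move=> x; apply/forall_inP/andP => [h|[/forall_inP h /forall_inP h'] i iD].
    split; last by apply/forall_inP => i /sD; exact: h.
    apply/forall_inP => z.
    by rewrite !inE => /orP[]/eqP -> //; apply: h.
  have [->|ii0] := eqVneq i i0; first by apply: h; rewrite !inE eqxx.
  by apply: h'; rewrite !inE ii0.
rewrite (@prob_indep C).
- rewrite prob_const ?inE ?eqxx ?orbT // !big_setU1 ?inE ?fg //= !big_set1.
  rewrite tE // exprS IH //.
  - by move=> i j /sD iD /sD jD; apply: fI.
  - by move=> i j /sD iD /sD jD; apply: gI.
  - by move=> i j /sD iD /sD jD; apply: fg.
  - by move=> i /sD; apply: tE.
- move=> x x' h; apply: eq_forallb_in => z zC; rewrite !h //.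
  by rewrite !inE eqxx orbT.
- move=> x x' h; apply: eq_forallb_in => i iD'.
  have /andP[ii0 iD] : (i != i0) && (i \in D) by move: iD'; rewrite !inE.
  rewrite !h // !inE negb_or.
    by rewrite eq_sym fg //= (inj_in_eq gI).
  by rewrite fg // andbT (inj_in_eq fI).
Qed.

(** With [N] the number of [i] for which [Q i] holds, [(N / mu - 1) ^+ 2] is nonnegative and equals
    1 where [N = 0], so its expectation dominates the probability of [N = 0]. *)
Lemma chebyshev_count (I : finType) (A : {set I}) (Q : I -> pred {ffun Z -> bool})
    (mu : R) : 0 < mu ->
    \sum_(i in A) prob (Q i) = mu ->
  1 - prob (fun x : {ffun Z -> bool} => [exists i in A, Q i x]) <=
  (\sum_(i in A) \sum_(j in A) prob (fun x => Q i x && Q j x)) / mu ^+ 2 - 1.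
Proof.
move=> mu0 Emu; pose N x : R := \sum_(i in A) (Q i x)%:R.
have EN : expect N = mu by rewrite /N expect_sum -Emu.
have EN2 : expect (fun x => N x ^+ 2) =
    \sum_(i in A) \sum_(j in A) prob (fun x => Q i x && Q j x).
  transitivity (expect (fun x => \sum_(i in A) \sum_(j in A)
                   ((Q i x && Q j x)%:R : R))).
    apply: eq_bigr => x _; congr (_ * _); rewrite expr2 big_distrlr /=.
    by apply: eq_bigr => i _; apply: eq_bigr => j _; rewrite -natrM mulnb.
  by rewrite expect_sum; apply: eq_bigr => i _; rewrite expect_sum.
rewrite -probC -EN2.
have -> : expect (fun x => N x ^+ 2) / mu ^+ 2 - 1 =
    expect (fun x => (N x / mu - 1) ^+ 2).
  transitivity (expect (fun x => N x ^+ 2) / mu ^+ 2 - 2 * (expect N / mu)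
                + expect (fun=> 1)).
    by rewrite EN expect1 divff ?gt_eqF //; ring.
  rewrite /expect !mulr_suml mulr_sumr -sumrB -big_split /=.
  apply: eq_bigr => x _.
  by field; rewrite gt_eqF.
apply: expect_le => x; case: (boolP [exists i in A, Q i x]) => [_|]; first exact: sqr_ge0.
rewrite negb_exists_in => /forall_inP h.
rewrite /N big1 ?mul0r ?sub0r ?sqrrN ?expr1n // => i iA.
by rewrite (negPf (h _ iA)).
Qed.

End ProductMeasure.

(** * Agreement along the links of a bipartite graph *)

(** Meant for a component with [j] and [k] vertices on the two sides and [e] links: degrees at most
    2 bound [e] from either side, and connectedness gives [n <= e.+1]. These counts replace a
    classification into paths and cycles. *)
Lemma link_arith (j k e n : nat) :
    n = (j + k)%N -> (e <= 2 * k)%N -> (e <= 2 * j)%N -> (n <= e.+1)%N ->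
  [/\ (j <= k.+1)%N, (k <= j.+1)%N,
      n = 2%N -> j = 1%N /\ k = 1%N &
      n = 1%N -> (j = 1%N /\ k = 0%N) \/ (j = 0%N /\ k = 1%N)].
Proof. by move=> *; split; lia. Qed.

Section Monochromatic.
Variables (R : realFieldType) (Z : finType) (c : Z -> bool) (p q r rho : R).
Variable H : rel Z.
Implicit Types C S : {set Z}.

Definition bit_wt (z : Z) (b : bool) : R :=
  if c z then (if b then p else 1 - p) else (if b then q else 1 - q).

Definition deg z := #|[set z' | H z z']|.

(* The product of these factors over the vertices of a component bounds the
   probability that the component is constant. *)
Definition deg_bound (d : nat) : R :=
  if d is d'.+1 then if d' is 0%N then r else r * rho else 1.

Definition agree_on S (x : {ffun Z -> bool}) :=
  [forall z in S, forall z', H z z' ==> (x z == x z')].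

Hypotheses (p01 : 0 < p < 1) (q01 : 0 < q < 1).
Hypotheses (r0 : 0 < r) (r1 : r <= 1) (rho0 : 0 < rho) (rho1 : rho <= 1).
Hypothesis rE : p * q + (1 - p) * (1 - q) = r ^+ 2.
Hypothesis rhoP : forall j k, (j <= k.+1)%N -> (k <= j.+1)%N -> (2 < j + k)%N ->
  p ^+ j * q ^+ k + (1 - p) ^+ j * (1 - q) ^+ k <= (r * rho) ^+ (j + k).
Hypotheses (Hsym : symmetric H) (Hc : forall z z', H z z' -> c z != c z').
Hypothesis Hdeg : forall z, (deg z <= 2)%N.

Lemma bit_wt_ge0 z b : 0 <= bit_wt z b.
Proof.
move/andP: p01 => [? ?]; move/andP: q01 => [? ?].
by rewrite /bit_wt; case: (c z); case: b; lra.
Qed.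

Lemma bit_wt_sum1 z : bit_wt z true + bit_wt z false = 1.
Proof. by rewrite /bit_wt; case: (c z); ring. Qed.

Lemma prod_bit_wt C b :
  \prod_(z in C) bit_wt z b =
  (if b then p else 1 - p) ^+ #|[set z in C | c z]| *
  (if b then q else 1 - q) ^+ #|[set z in C | ~~ c z]|.
Proof.
rewrite (bigID c) /= -!prodr_const; congr (_ * _).
  by apply: eq_big => [z|z /andP[_ cz]]; rewrite ?inE // /bit_wt cz.
by apply: eq_big => [z|z /andP[_ /negPf cz]]; rewrite ?inE // /bit_wt cz.
Qed.

(** Links are oriented away from the side where [c] holds, so that each is counted once. *)
Definition inner_links C :=
  [set u : Z * Z | (u.1 \in C) && c u.1 && ((u.2 \in C) && H u.1 u.2)].

Lemma inner_links_sum C :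
  #|inner_links C| = (\sum_(u | (u \in C) && c u) \sum_(v | (v \in C) && H u v) 1)%N.
Proof. by rewrite pair_big_dep /= sum1dep_card. Qed.

Lemma sum_deg_le (A : pred Z) C :
  (\sum_(u | (u \in C) && A u) \sum_(v | (v \in C) && H u v) 1
     <= 2 * #|[set z in C | A z]|)%N.
Proof.
rewrite (eq_bigl (fun z => z \in [set z in C | A z])); last by move=> z; rewrite !inE.
rewrite mulnC -sum_nat_const; apply: leq_sum => u _.
rewrite sum1dep_card (leq_trans _ (Hdeg u)) // subset_leq_card //.
by apply/subsetP => v; rewrite !inE => /andP[].
Qed.

Lemma inner_links_le1 C : (#|inner_links C| <= 2 * #|[set z in C | c z]|)%N.
Proof. by rewrite inner_links_sum sum_deg_le. Qed.

Lemma inner_links_le2 C : (#|inner_links C| <= 2 * #|[set z in C | ~~ c z]|)%N.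
Proof.
rewrite inner_links_sum.
rewrite (exchange_big_dep (fun v => (v \in C) && ~~ c v)) /=.
  rewrite (leq_trans _ (sum_deg_le (fun v => ~~ c v) C)) // leq_sum //= => v vP.
  rewrite !sum1dep_card subset_leq_card //; apply/subsetP => u.
  by rewrite !inE Hsym => /andP[/andP[-> _]] /andP[].
by move=> u v /andP[_ cu] /andP[-> /Hc]; rewrite cu; case: (c v).
Qed.

Lemma card_split C : #|C| = (#|[set z in C | c z]| + #|[set z in C | ~~ c z]|)%N.
Proof.
rewrite -(cardsID [set z | c z] C); congr (_ + _)%N; apply: eq_card => z;
by rewrite !inE // andbC.
Qed.

(* A maximal set on which agreement is forced by at least [#|C| - 1] links is
   a connected component. *)
Lemma component S z0 : z0 \in S ->
    {in S, forall z z', H z z' -> z' \in S} ->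
  exists C : {set Z}, [/\ z0 \in C, C \subset S,
     (#|C| <= #|inner_links C|.+1)%N,
     {in C, forall z z', H z z' -> z' \in C} &
     forall x, agree_on S x -> [forall z in C, x z == x z0]].
Proof.
move=> z0S Scl.
pose good (C : {set Z}) := [&& z0 \in C, C \subset S,
   (#|C| <= #|inner_links C|.+1)%N &
   [forall x : {ffun Z -> bool}, agree_on S x ==> [forall z in C, x z == x z0]]].
have good0 : good [set z0].
  rewrite /good set11 sub1set z0S cards1 /=.
  by apply/forallP => x; apply/implyP => _; apply/forall_inP => z /set1P ->.
have [C /maxsetP[/and4P[z0C sCS eC /forallP agC] Cmax] _] := maxset_exists good0.
exists C; split=> //; last by move=> x /(implyP (agC x)).
move=> z zC z' Hzz'; apply/negPn/negP => z'C.
have zS := subsetP sCS _ zC.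
suff gz' : good (z' |: C).
  by move/negP: z'C; apply; rewrite -(Cmax _ gz') ?subsetUr // setU11.
rewrite /good !inE z0C orbT subUset sub1set (Scl z) // sCS /=; apply/andP; split.
  rewrite cardsU1 z'C add1n ltnS (leq_trans eC) //.
  (* The link leaving [C], oriented as in [inner_links]: its outer end adds one vertex and at least
     this one link. *)
  pose u := if c z then (z, z') else (z', z).
  have uC : u \notin inner_links C.
    rewrite inE /u; case: ifP => _ /=; by rewrite (negPf z'C) ?andbF.
  rewrite -[_.+1]/(1 + _)%N; have -> : (1 + #|inner_links C| = #|u |: inner_links C|)%N.
    by rewrite cardsU1 uC.
  apply: subset_leq_card; apply/subsetP => v; rewrite in_setU1 => /orP[/eqP ->|].
    rewrite inE /u; have := Hc Hzz'.
    by case: ifP => cz cz' /=; rewrite !inE eqxx zC ?Hzz' ?cz ?orbT // Hsym Hzz';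
      case: (c z') cz'.
  by rewrite !inE => /andP[/andP[-> ->]] /andP[-> ->]; rewrite !orbT.
apply/forallP => x; apply/implyP => agx; apply/forall_inP => y.
have /forall_inP xC := implyP (agC x) agx.
rewrite in_setU1 => /orP[/eqP ->|]; last exact: xC.
rewrite -(eqP (xC _ zC)) eq_sym.
by move/forall_inP: agx => /(_ _ zS) /forallP /(_ z') /implyP; apply.
Qed.

Lemma deg_bound_ge d : r * rho <= deg_bound d.
Proof.
have : r * rho <= r by rewrite ger_pMr.
by case: d => [|[|d]] //= h; apply: le_trans h r1.
Qed.

(** For three or more vertices [rhoP] already gives [r * rho] per vertex. For two, the probability
    is [r ^+ 2] and no degree exceeds 1. A single vertex is isolated and both sides are 1. *)
Lemma component_bound C z0 : z0 \in C ->
    (#|C| <= #|inner_links C|.+1)%N ->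
    {in C, forall z z', H z z' -> z' \in C} ->
  prob bit_wt (fun x : {ffun Z -> bool} => [forall z in C, x z == x z0]) <=
  \prod_(z in C) deg_bound (deg z).
Proof.
move=> z0C eC Ccl; rewrite prob_const //; last exact: bit_wt_sum1.
rewrite !prod_bit_wt /=.
have := inner_links_le1 C; have := inner_links_le2 C; have := card_split C.
set j := #|[set z in C | c z]|; set k := #|[set z in C | ~~ c z]| => cC e2 e1.
have C0 : (0 < #|C|)%N by apply/card_gt0P; exists z0.
have [jk kj jk2 jk1] := link_arith cC e2 e1 eC.
have [C3|C3] := ltnP 2 #|C|.
  apply: le_trans (rhoP jk kj _) _; first by rewrite -cC.
  rewrite -cC -prodr_const; apply: ler_prod => z _.
  by rewrite deg_bound_ge andbT mulr_ge0 ?ltW.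
have [C2|C2] := eqVneq #|C| 2.
  have [-> ->] := jk2 C2.
  rewrite !expr1 rE.
  have -> : r ^+ 2 = \prod_(z in C) r by rewrite prodr_const C2.
   apply: ler_prod => z zC.
  rewrite ltW //=.
  have : (deg z <= 1)%N.
    have <- : #|C :\ z| = 1%N by move: C2; rewrite (cardsD1 z) zC => -[].
    apply: subset_leq_card; apply/subsetP => z'; rewrite !inE => Hz.
    rewrite (Ccl z) // andbT; apply/eqP => zz'.
    by have := Hc Hz; rewrite zz' eqxx.
  by case: (deg z) => [|[|]].
have C1 : #|C| = 1%N by move: C0 C3 C2; clear; case: #|C| => [|[|[|]]].
have CE : C = [set z0].
  by apply/eqP; rewrite eq_sym eqEcard sub1set z0C cards1 C1.
have -> : \prod_(z in C) deg_bound (deg z) = 1.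
  rewrite CE big_set1; suff -> : deg z0 = 0%N by [].
  apply/eqP; rewrite cards_eq0; apply/eqP/setP => z'; rewrite !inE.
  apply/negP => Hz; have := Ccl _ z0C _ Hz; rewrite CE inE => /eqP zz'.
  by have := Hc Hz; rewrite zz' eqxx.
have [[-> ->]|[-> ->]] := jk1 C1.
  by rewrite !expr0 !expr1; lra.
by rewrite !expr0 !expr1; lra.
Qed.

(** Distinct components read disjoint coordinates, hence are independent; an induction on [#|S|]
    removes one component at a time. *)
Lemma prob_agree_on S : {in S, forall z z', H z z' -> z' \in S} ->
  prob bit_wt (agree_on S) <= \prod_(z in S) deg_bound (deg z).
Proof.
have [n] := ubnP #|S|; elim: n S => // n IH S cS Scl.
have [->|[z0 z0S]] := set_0Vmem S.
  rewrite big_set0 -(expect1 bit_wt_sum1); apply: expect_le => [|x].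
    exact: bit_wt_ge0.
  by rewrite lern1; case: (agree_on _ _).
have [C [z0C sCS eC Ccl agC]] := component z0S Scl.
have SCcl : {in S :\: C, forall z z', H z z' -> z' \in S :\: C}.
  move=> z; rewrite !inE => /andP[zC zS] z' Hz; rewrite inE (Scl z) // andbT.
  by apply: contra zC => z'C; apply: (Ccl z') => //; rewrite Hsym.
rewrite (big_setID C) /= (setIidPr sCS).
apply: (@le_trans _ _ (prob bit_wt (fun x : {ffun Z -> bool} =>
          [forall z in C, x z == x z0] && agree_on (S :\: C) x))).
  apply: prob_le => [|x agx]; first exact: bit_wt_ge0.
  rewrite agC //; apply/forall_inP => z /setDP[zS _].
  exact: (forall_inP agx).
rewrite (@prob_indep _ _ _ bit_wt_sum1 C).
- apply: ler_pM; rewrite ?prob_ge0 //; try exact: bit_wt_ge0.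
    exact: component_bound.
  apply: IH => //; rewrite (leq_trans _ (cS : (#|S| <= n)%N)) //.
  rewrite proper_card // properE subsetDl /=; apply/subsetPn; exists z0 => //.
  by rewrite inE z0C.
- by move=> x x' h; apply: eq_forallb_in => z zC; rewrite !h.
- move=> x x' h; apply: eq_forallb_in => z zS; apply: eq_forallb => z'.
  case Hz : (H z z') => //=; rewrite !h //.
    by have := SCcl _ zS _ Hz; rewrite !inE => /andP[].
  by move: zS; rewrite !inE => /andP[].
Qed.

Lemma prob_agree : prob bit_wt (fun x : {ffun Z -> bool} =>
    [forall z, forall z', H z z' ==> (x z == x z')]) <= \prod_z deg_bound (deg z).
Proof.
have := @prob_agree_on setT (fun _ _ _ _ => in_setT _).
rewrite (eq_bigl xpredT) => [|z]; last by rewrite inE.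
apply: le_trans; apply: prob_le => [|x h]; first exact: bit_wt_ge0.
by apply/forall_inP => z _; apply: (forallP h).
Qed.

End Monochromatic.

(** * Overlaps of two pairs of injections *)

Definition pairs (T : finType) : {set {set T}} := [set e : {set T} | #|e| == 2%N].

Lemma card_pairs (T : finType) : #|pairs T| = 'C(#|T|, 2).
Proof. exact: card_draws. Qed.

Lemma card_pairs_in (T : finType) (K : {set T}) :
  #|[set e in pairs T | e \subset K]| = 'C(#|K|, 2).
Proof. by rewrite -cards_draws; apply: eq_card => e; rewrite !inE andbC. Qed.

Section Overlap.
Variables (I V : finType).
Implicit Types a b : {ffun I -> V}.

(** Overlaps and fixed points are both recorded as indices of the second pair, so that the fixed
    points lie in the overlap of either side. *)
Definition overlap a a' : {set I} := [set j | a' j \in codom a].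
Definition fixed_part a b a' b' : {set I} :=
  [set j | [exists i, (a' j == a i) && (b' j == b i)]].

Lemma fixed_part_sub a b a' b' : fixed_part a b a' b' \subset overlap a a'.
Proof.
apply/subsetP => j; rewrite !inE => /existsP[i /andP[/eqP -> _]].
exact: codom_f.
Qed.

Lemma fixed_partC a b a' b' : fixed_part b a b' a' = fixed_part a b a' b'.
Proof. by apply/setP => j; rewrite !inE; apply: eq_existsb => i; rewrite andbC. Qed.

(** The doubly covered potential edges with two different partners, which earn the factor [rho]. *)
Definition split_pairs a b a' b' : {set {set I}} :=
  [set e' in pairs I | [exists e in pairs I,
     (a @: e == a' @: e') && (b @: e != b' @: e')]].

(* A pair of overlapping points on which both maps agree as on sets either
   consists of fixed points or is swapped. *)
Lemma card_split_pairs a b a' b' :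
    injective a -> injective b -> injective a' -> injective b' ->
  ('C(#|overlap a a'|, 2) <= #|split_pairs a b a' b'| +
     ('C(#|fixed_part a b a' b'|, 2) + (#|overlap a a'| - #|fixed_part a b a' b'|)))%N.
Proof.
move=> aI bI aI' bI'; set K := overlap a a'; set F := fixed_part a b a' b'.
set Dis := split_pairs a b a' b'.
(* A swapped pair is recovered from either of its points as [[set j; sw j]], so there are at most as
   many swapped pairs as points of [K] outside [F]. *)
pose sw j := odflt j [pick j' | [exists i, (a' j == a i) && (b' j' == b i)]].
rewrite -card_pairs_in -[X in (_ <= _ + (X + _))%N]card_pairs_in.
have -> : (#|K| - #|F| = #|K :\: F|)%N.
  by rewrite cardsD (setIidPr (fixed_part_sub _ _ _ _)).
apply: leq_trans (leq_add (leqnn _) (leq_add (leqnn _)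
  (leq_imset_card (fun j => [set j; sw j]) _))).
apply: leq_trans (leq_add (leqnn _) (leq_card_setU _ _)).
apply: leq_trans (leq_card_setU _ _).
apply: subset_leq_card; apply/subsetP => e'; rewrite inE => /andP[e'2 e'K].
rewrite !in_setU; case: (boolP (e' \in Dis)) => //= e'D.
have /cards2P[j1 [j2 [j12 eE]]] : #|e'| == 2%N by move: e'2; rewrite inE.
have /codomP[i1 ji1] : a' j1 \in codom a.
  by have := subsetP e'K j1; rewrite eE !inE eqxx => /(_ isT).
have /codomP[i2 ji2] : a' j2 \in codom a.
  by have := subsetP e'K j2; rewrite eE !inE eqxx orbT => /(_ isT).
have i12 : i1 != i2.
  by apply: contra j12 => /eqP i12; apply/eqP/aI'; rewrite ji1 ji2 i12.
have bE : [set b i1; b i2] = [set b' j1; b' j2].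
  apply/eqP/negPn/negP => bN; move/negP: e'D; apply; rewrite inE e'2 /=.
  apply/exists_inP; exists [set i1; i2]; first by rewrite inE cards2 i12.
  by rewrite eE !imsetU1 !imset_set1 ji1 ji2 eqxx.
have b1 : b' j1 \in [set b i1; b i2] by rewrite bE !inE eqxx.
have b2 : b' j2 \in [set b i1; b i2] by rewrite bE !inE eqxx orbT.
have b12 : b' j1 != b' j2 by rewrite (inj_eq bI').
move: b1 b2 b12; rewrite !inE => /orP[]/eqP b1 /orP[]/eqP b2.
- by rewrite b1 b2 eqxx.
- move=> _; apply/orP; left; rewrite eE cards2 j12 /=.
  apply/subsetP => j; rewrite !inE => /orP[]/eqP ->; apply/existsP.
    by exists i1; rewrite ji1 b1 !eqxx.
  by exists i2; rewrite ji2 b2 !eqxx.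
- move=> _; apply/orP; right; apply/imsetP; exists j1.
    rewrite inE [_ \in K]inE ji1 codom_f andbT inE.
    apply/existsP => -[i /andP[/eqP]]; rewrite ji1 => /aI <-.
    by rewrite b1 (inj_eq bI) eq_sym (negPf i12).
  rewrite eE; congr [set _; _]; rewrite /sw; case: pickP => [j|/(_ j2)].
    by move=> /existsP[i /andP[/eqP]]; rewrite ji1 => /aI <- /eqP; rewrite -b2 => /bI'.
  by move=> /existsP[]; exists i1; rewrite ji1 b2 !eqxx.
- by rewrite b1 b2 eqxx.
Qed.

Definition linked a b a' b' (e e' : {set V}) :=
  [exists d in pairs I, ((a @: d == e) && (b @: d == e')) ||
                        ((a' @: d == e) && (b' @: d == e'))].

(** Exchanging the roles of the two graphs carries the degree bounds for X over to Y. *)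
Lemma linkedC a b a' b' e e' : linked b a b' a' e' e = linked a b a' b' e e'.
Proof.
by apply: eq_existsb => d; rewrite andbC [in LHS]andbC; congr (_ && _);
  rewrite [X in X || _]andbC [X in _ || X]andbC.
Qed.

Definition ldeg a b a' b' e := #|[set e' | linked a b a' b' e e']|.

Lemma ldeg_le2 a b a' b' e : injective a -> injective a' ->
  (ldeg a b a' b' e <= 2)%N.
Proof.
move=> aI aI'.
(* The only neighbour that one pair can contribute; [set0] stands in when [e] is not an image. *)
pose nb (g h : {ffun I -> V}) : {set V} :=
  odflt set0 (omap (fun d : {set I} => h @: d) [pick d : {set I} | g @: d == e]).
apply: (@leq_trans #|[set nb a b; nb a' b']|); last by rewrite cards2; case: eqP.
apply: subset_leq_card; apply/subsetP => e'; rewrite !inE.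
move=> /exists_inP[d _ /orP[]/andP[/eqP ae /eqP <-]]; apply/orP; [left|right];
  rewrite /nb; case: pickP => [d' /eqP|/(_ d)]; rewrite ?ae ?eqxx // -ae.
  by move/(imset_inj aI) ->.
by move/(imset_inj aI') ->.
Qed.

Lemma split_pairs_ldeg a b a' b' e' : e' \in split_pairs a b a' b' ->
  (2 <= ldeg a b a' b' (a' @: e'))%N.
Proof.
rewrite inE => /andP[e'2 /exists_inP[e e2 /andP[/eqP aE bN]]].
have <- : #|[set b @: e; b' @: e']| = 2%N by rewrite cards2 bN.
apply: subset_leq_card; apply/subsetP => d; rewrite !inE => /orP[]/eqP ->.
  by apply/exists_inP; exists e; rewrite // aE !eqxx.
by apply/exists_inP; exists e'; rewrite // !eqxx orbT.
Qed.

Definition image_pairs a : {set {set V}} := [set a @: (d : {set I}) | d in pairs I].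

Lemma ldeg_gt0 a b a' b' e : e \in image_pairs a :|: image_pairs a' ->
  (0 < ldeg a b a' b' e)%N.
Proof.
move=> h; rewrite card_gt0; apply/set0Pn.
move: h; rewrite in_setU => /orP[]/imsetP[d d2 ->].
  by exists (b @: d); rewrite inE; apply/exists_inP; exists d; rewrite ?eqxx.
by exists (b' @: d); rewrite inE; apply/exists_inP; exists d; rewrite ?eqxx ?orbT.
Qed.

(** Inclusion-exclusion: an edge in both images comes from a pair of overlapping indices. *)
Lemma card_image_pairs_union a a' : injective a -> injective a' ->
  (2 * 'C(#|I|, 2) <=
     #|image_pairs a :|: image_pairs a'| + 'C(#|overlap a a'|, 2))%N.
Proof.
move=> aI aI'.
rewrite -card_pairs_in cardsU !card_imset; try exact: imset_inj.
rewrite card_pairs addnn -mul2n.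
suff : (#|image_pairs a :&: image_pairs a'|
  <= #|[set e in pairs I | e \subset overlap a a']|)%N by lia.
rewrite -[X in (_ <= X)%N](card_imset _ (imset_inj aI')).
apply: subset_leq_card; apply/subsetP => e; rewrite inE.
move=> /andP[/imsetP[d d2 ->] /imsetP[d' d'2 aE]]; rewrite aE.
apply: imset_f; rewrite inE d'2 /=; apply/subsetP => j jd'; rewrite inE.
have : a' j \in a @: d by rewrite aE imset_f.
by case/imsetP => i _ ->; exact: codom_f.
Qed.

End Overlap.

(** * Degree factors of the potential edges of one graph *)

Section SideBound.
Variables (R : realFieldType) (I V : finType) (r rho u : R).
Hypotheses (r0 : 0 < r) (r1 : r <= 1) (rho0 : 0 < rho) (rho1 : rho <= 1).
Hypotheses (u1 : 1 <= u) (uE : u ^+ 2 * r = rho).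
Implicit Types a b : {ffun I -> V}.

(** A covered potential edge has positive degree and contributes at most [r]; two different partners
    give degree 2 and one more factor [rho]. *)
Lemma prod_ldeg_bound a b a' b' :
    injective a -> injective b -> injective a' -> injective b' ->
  \prod_e deg_bound r rho (ldeg a b a' b' e) <=
  r ^+ #|image_pairs a :|: image_pairs a'|
  * rho ^+ #|split_pairs a b a' b'|.
Proof.
move=> aI bI aI' bI'; set U := _ :|: _; set Dis := split_pairs _ _ _ _.
set Dis' := (fun d : {set I} => a' @: d) @: Dis.
have sDis : Dis' \subset U.
  apply/subsetP => e /imsetP[e' eD ->]; rewrite in_setU [X in _ || X]imset_f ?orbT //.
  by move: eD; rewrite inE => /andP[].
have -> : #|Dis| = #|Dis'| by rewrite card_imset //; exact: imset_inj.
rewrite -!prodr_const [X in X * _]big_mkcond [X in _ * X]big_mkcond /= -big_split /=.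
apply: ler_prod => e _; apply/andP; split.
  by case: (ldeg _ _ _ _ _) => [|[|?]] /=; rewrite ?mulr_ge0 ?ltW.
case: ifPn => eU; last first.
  rewrite (negPf (contra (subsetP sDis e) eU)) mulr1.
  by case: (ldeg _ _ _ _ _) => [|[|?]] //=; apply: le_trans r1; rewrite ger_pMr.
have := ldeg_gt0 b b' eU; case: ifPn => [/imsetP[e' eD ->]|_].
  by have := split_pairs_ldeg eD; case: (ldeg _ _ _ _ _) => [|[|?]].
by case: (ldeg _ _ _ _ _) => [|[|?]] //= _; rewrite mulr1 // ger_pMr.
Qed.

(** The left side is [(k - f) * (k + f - 1)]; replacing [k] by [m] frees the second factor from the
    overlap. *)
Lemma bin2_diff k f m : (f <= k)%N -> (k <= m)%N ->
  (2 * ('C(k, 2) - 'C(f, 2)) <= (k - f) * (m + f))%N.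
Proof.
move=> fk km; rewrite mulnBr (mul_bin_left k 1) (mul_bin_left f 1) !bin1.
nia.
Qed.

(** At most ['C(k, 2)] edges are shared, and [card_split_pairs] provides a factor [rho] for all of
    these up to ['C(f, 2) + (k - f)]. Since [rho = u ^+ 2 * r], the surviving powers of [r] and
    [rho] merge into a power of [u], whose exponent is bounded by [bin2_diff]. *)
Lemma side_bound a b a' b' :
    injective a -> injective b -> injective a' -> injective b' ->
  \prod_e deg_bound r rho (ldeg a b a' b' e) <=
  r ^+ (2 * 'C(#|I|, 2)) / r ^+ 'C(#|fixed_part a b a' b'|, 2) *
  (u ^+ (#|I| + #|fixed_part a b a' b'|) / rho) ^+ (#|overlap a a'| - #|fixed_part a b a' b'|).
Proof.
move=> aI bI aI' bI'; set f := #|fixed_part _ _ _ _|.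
apply: le_trans (prod_ldeg_bound aI bI aI' bI') _.
have := card_split_pairs aI bI aI' bI'; have := card_image_pairs_union aI aI'.
have := subset_leq_card (fixed_part_sub a b a' b').
have : (#|overlap a a'| <= #|I|)%N by exact: max_card.
set k := #|overlap a a'|; set m := #|I|.
set U := #|_ :|: _|; set D := #|split_pairs _ _ _ _| => km fk hU hD.
have t1 : r ^+ U <= r ^+ (2 * 'C(m, 2)) / r ^+ 'C(k, 2).
  by rewrite ler_pdivlMr ?exprn_gt0 // -exprD; apply: ler_wiXn2l => //; exact: ltW.
have t2 : rho ^+ D <= rho ^+ 'C(k, 2) / (rho ^+ 'C(f, 2) * rho ^+ (k - f)).
  rewrite ler_pdivlMr ?mulr_gt0 ?exprn_gt0 // -!exprD.
  by apply: ler_wiXn2l => //; exact: ltW.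
apply: le_trans (ler_pM _ _ t1 t2) _; rewrite ?exprn_ge0 ?(ltW r0) ?(ltW rho0) //.
have C_fk : ('C(f, 2) <= 'C(k, 2))%N by exact: leq_bin2l.
have uX : u ^+ (2 * ('C(k, 2) - 'C(f, 2))) <= (u ^+ (m + f)) ^+ (k - f).
  by rewrite -exprM; apply: ler_weXn2l => //; rewrite [((m + f) * _)%N]mulnC bin2_diff.
have -> : r ^+ (2 * 'C(m, 2)) / r ^+ 'C(k, 2) *
   (rho ^+ 'C(k, 2) / (rho ^+ 'C(f, 2) * rho ^+ (k - f))) =
   r ^+ (2 * 'C(m, 2)) / r ^+ 'C(f, 2) *
   (u ^+ (2 * ('C(k, 2) - 'C(f, 2))) / rho ^+ (k - f)).
  have E d : rho ^+ d = u ^+ (2 * d) * r ^+ d by rewrite -uE exprMn exprM.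
  set A := r ^+ (2 * _); set d := ('C(k, 2) - 'C(f, 2))%N.
  have -> : 'C(k, 2) = (d + 'C(f, 2))%N by rewrite subnK.
  have := E d; move: (u ^+ (2 * d)) => ud Ed.
  rewrite !(exprD _ d) Ed.
  by field; rewrite !expf_neq0 // gt_eqF.
rewrite exprMn exprVn ler_wpM2l ?ler_wpM2r ?invr_ge0 ?exprn_ge0 ?(ltW rho0) //.
by rewrite mulr_ge0 ?invr_ge0 ?exprn_ge0 // ltW.
Qed.

End SideBound.

Lemma sum_card (R : nzSemiRingType) (I : finType) (h : nat -> R) :
  \sum_(F : {set I}) h #|F| = \sum_(f < #|I|.+1) ('C(#|I|, f)%:R * h f).
Proof.
rewrite (partition_big (fun F : {set I} => inord #|F| : 'I_#|I|.+1) xpredT) //=.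
apply: eq_bigr => f _.
transitivity (\sum_(F in [set F : {set I} | #|F| == f :> nat]) h f).
  have FE (F : {set I}) : (inord #|F| == f) = (#|F| == f :> nat).
    by rewrite -val_eqE /= inordK // ltnS max_card.
  apply: eq_big => [F|F]; first by rewrite inE FE.
  by rewrite FE => /eqP ->.
by rewrite sumr_const card_draws mulr_natl.
Qed.

(** * Weighted count of the second pairs by their fixed points *)

Section Counting.
Variables (R : realFieldType) (I V : finType).
Implicit Types a b : {ffun I -> V}.

Section FixedF.
Variables (a : {ffun I -> V}) (y : R) (F : {set I}).
Hypotheses (aI : injective a) (y0 : 0 <= y).

(* [s] prescribes the values on [F]; each further value taken in the image of
   [a] costs a factor [y]. *)
Definition ext_wt (s : {ffun {j | j \in F} -> I}) (j : I) (v : V) : R :=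
  if insub j is Some j0 then (v == a (s j0))%:R else if v \in codom a then y else 1.

Lemma ext_wt_ge0 s j v : 0 <= ext_wt s j v.
Proof.
by rewrite /ext_wt; case: insubP => [*|_]; [exact: ler0n | case: ifP].
Qed.

(** Summing over all maps, not only injections, factors the sum over coordinates: a coordinate in
    [F] has one admissible value, any other contributes at most [#|V| + #|I| * y]. *)
Lemma sum_ext_wt s :
  \sum_(a' : {ffun I -> V}) \prod_j ext_wt s j (a' j)
  <= (#|V|%:R + #|I|%:R * y) ^+ (#|I| - #|F|).
Proof.
rewrite -(bigA_distr_bigA (ext_wt s)) (bigID (mem F)) /=.
rewrite big1 => [|j jF]; last first.
  rewrite (bigD1 (a (s (Sub j jF)))) //= big1 ?addr0 => [|v /negPf vN].
    by rewrite /ext_wt insubT eqxx.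
  by rewrite /ext_wt insubT vN.
have <- : #|~: F| = (#|I| - #|F|)%N by rewrite -(cardsC F) addnC addnK.
rewrite mul1r -prodr_const (eq_bigl (fun j => j \in ~: F)) => [|j]; last by rewrite inE.
apply: ler_prod => j; rewrite inE => jF; apply/andP; split.
  by apply: sumr_ge0 => v _; exact: ext_wt_ge0.
rewrite (eq_bigr (fun v => if v \in codom a then y else 1)) => [|v _]; last first.
  by rewrite /ext_wt insubN.
rewrite (bigID (mem (codom a))) /= addrC; apply: lerD.
  rewrite (eq_bigr (fun=> 1)) => [|v /negPf -> //].
  by rewrite sumr_const ler_nat max_card.
rewrite (eq_bigr (fun=> y)) => [|v -> //].
by rewrite sumr_const card_codom // mulr_natl.
Qed.

Lemma ext_wt_prod (s : {ffun {j | j \in F} -> I}) a' :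
    injective a' -> F \subset overlap a a' ->
    (forall j (jF : j \in F), a' j = a (s (Sub j jF))) ->
  \prod_j ext_wt s j (a' j) = y ^+ (#|overlap a a'| - #|F|).
Proof.
move=> aI' sF E.
transitivity (\prod_(j in overlap a a' :\: F) y); last first.
  by rewrite prodr_const cardsD (setIidPr sF).
rewrite [RHS]big_mkcond; apply: eq_bigr => j _; rewrite !inE /ext_wt.
case: insubP => [j0 jF jE|/negPf -> //]; rewrite jF /=.
have -> : a' j = a (s j0) by rewrite (E _ jF); congr (a (s _)); exact: val_inj.
by rewrite eqxx.
Qed.

End FixedF.

Lemma fixed_part_matching a b a' b' : injective a -> injective a' ->
  exists s : {ffun {j | j \in fixed_part a b a' b'} -> I}, injective s /\
    forall j (jF : j \in fixed_part a b a' b'),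
      a' j = a (s (Sub j jF)) /\ b' j = b (s (Sub j jF)).
Proof.
move=> aI aI'; set F := fixed_part _ _ _ _.
have ex (j : {j | j \in F}) : exists i, (a' (val j) == a i) && (b' (val j) == b i).
  by have := valP j; rewrite inE => /existsP[i ?]; exists i.
pose s := [ffun j => xchoose (ex j)].
have sP j : a' (val j) = a (s j) /\ b' (val j) = b (s j).
  by rewrite ffunE; have /andP[/eqP ? /eqP ?] := xchooseP (ex j).
exists s; split=> [j j' ss|j jF]; last exact: (sP (Sub j jF)).
by apply/val_inj/aI'; have [-> _] := sP j; have [-> _] := sP j'; rewrite ss.
Qed.

(** On a given set [F] of fixed points, [a'] and [b'] are determined by one common injection [s] of
    [F] into [I], whence the falling factorial; off [F] the two maps are summed independently with
    the weights [ext_wt]. *)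
Lemma sum_overlap a b (h y : nat -> R) : injective a -> injective b ->
    (forall f, 0 <= h f) -> (forall f, 0 <= y f) ->
  \sum_(a' : {ffun I -> V} | injectiveb a') \sum_(b' : {ffun I -> V} | injectiveb b')
    (h #|fixed_part a b a' b'| * y #|fixed_part a b a' b'| ^+
      ((#|overlap a a'| - #|fixed_part a b a' b'|) +
       (#|overlap b b'| - #|fixed_part a b a' b'|)))
  <= \sum_(f < #|I|.+1) ('C(#|I|, f)%:R * ((#|I| ^_ f)%:R * h f *
        (#|V|%:R + #|I|%:R * y f) ^+ (2 * (#|I| - f)))).
Proof.
move=> aI bI h0 y0; rewrite pair_big /=.
rewrite -(sum_card _ (fun f => (#|I| ^_ f)%:R * h f *
        (#|V|%:R + #|I|%:R * y f) ^+ (2 * (#|I| - f)))).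
rewrite (partition_big (fun u => fixed_part a b u.1 u.2) xpredT) //=.
apply: ler_sum => F _; set Y := y #|F|.
pose w (c : {ffun I -> V}) (s : {ffun {j | j \in F} -> I}) (c' : {ffun I -> V}) :=
  \prod_j ext_wt c Y s j (c' j).
have w0 c s c' : 0 <= w c s c' by apply: prodr_ge0 => j _; exact/ext_wt_ge0/y0.
apply: (@le_trans _ _ (\sum_(u : {ffun I -> V} * {ffun I -> V}) h #|F| *
    \sum_(s : {ffun {j | j \in F} -> I} | injectiveb s) w a s u.1 * w b s u.2)).
  rewrite big_mkcond; apply: ler_sum => -[a' b'] _ /=.
  case: ifP => [/andP[/andP[/injectiveP aI' /injectiveP bI'] /eqP FE]|_]; last first.
    by rewrite mulr_ge0 // sumr_ge0 // => s _; rewrite mulr_ge0.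
  rewrite FE; apply: ler_wpM2l => //.
  have [s [sI sE]] := fixed_part_matching b b' aI aI'; rewrite FE in s sI sE *.
  rewrite (bigD1 s) /=; last exact/injectiveP.
  rewrite /w !ext_wt_prod //.
  - by rewrite -exprD lerDl sumr_ge0 // => s' _; apply: mulr_ge0; apply: w0.
  - by rewrite -FE -fixed_partC fixed_part_sub.
  - by move=> j jF; have [] := sE j jF.
  - by rewrite -FE fixed_part_sub.
  - by move=> j jF; have [] := sE j jF.
rewrite -mulr_sumr exchange_big /=.
rewrite [_%:R * h _]mulrC -mulrA; apply: ler_wpM2l => //.
have -> : (#|I| ^_ #|F|)%:R =
    \sum_(s : {ffun {j | j \in F} -> I} | injectiveb s) (1 : R).
  rewrite -[in LHS](card_sig (mem F)) -card_inj_ffuns -sum1dep_card natr_sum.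
  by apply: eq_big.
rewrite mulr_suml; apply: ler_sum => s _; rewrite mul1r mul2n -addnn exprD.
rewrite -(pair_bigA _ (fun a' b' => w a s a' * w b s b')) /= -big_distrlr /=.
apply: ler_pM; try by apply: sumr_ge0 => c _; exact: w0.
  exact: (sum_ext_wt aI (y0 _)).
exact: (sum_ext_wt bI (y0 _)).
Qed.

End Counting.

(** * First and second moments of the number of matchings *)

Section Events.
Variables (R : realFieldType) (I V : finType) (p q r rho u : R).
Hypotheses (p01 : 0 < p < 1) (q01 : 0 < q < 1).
Hypotheses (r0 : 0 < r) (r1 : r <= 1) (rho0 : 0 < rho) (rho1 : rho <= 1).
Hypothesis rE : p * q + (1 - p) * (1 - q) = r ^+ 2.
Hypothesis rhoP : forall j k, (j <= k.+1)%N -> (k <= j.+1)%N -> (2 < j + k)%N ->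
  p ^+ j * q ^+ k + (1 - p) ^+ j * (1 - q) ^+ k <= (r * rho) ^+ (j + k).
Hypotheses (u1 : 1 <= u) (uE : u ^+ 2 * r = rho).
Implicit Types a b : {ffun I -> V}.

Definition event a b (x : {ffun bool * {set V} -> bool}) :=
  [forall d in pairs I, x (true, a @: d) == x (false, b @: d)].

Let wt := bit_wt (@fst bool {set V}) p q.

Lemma prob_event a b : injective a -> injective b ->
  prob wt (event a b) = (r ^+ 2) ^+ 'C(#|I|, 2).
Proof.
move=> aI bI; rewrite -card_pairs.
apply: (@prob_matching _ _ _ _ _ _ (fun d : {set I} => (true, a @: d))
  (fun d : {set I} => (false, b @: d))).
- exact: bit_wt_sum1.
- by move=> d d' _ _ [] /(imset_inj aI).
- by move=> d d' _ _ [] /(imset_inj bI).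
- by [].
- by move=> d _; rewrite /wt /bit_wt /= rE.
Qed.

(** The tag [true] marks coordinates of X and [false] those of Y. The product of degree factors
    splits along the tag, and [side_bound] applies to each half, with [a] and [b] exchanged for
    Y. *)
Lemma prob_event2 a b a' b' :
    injective a -> injective b -> injective a' -> injective b' ->
  prob wt (fun x => event a b x && event a' b' x) <=
  (r ^+ 2) ^+ (2 * 'C(#|I|, 2)) * ((r ^+ 2) ^- 'C(#|fixed_part a b a' b'|, 2) *
    (u ^+ (#|I| + #|fixed_part a b a' b'|) / rho) ^+
      ((#|overlap a a'| - #|fixed_part a b a' b'|) +
       (#|overlap b b'| - #|fixed_part a b a' b'|))).
Proof.
move=> aI bI aI' bI'.
pose H (z z' : bool * {set V}) := if z.1
  then ~~ z'.1 && linked a b a' b' z.2 z'.2 else z'.1 && linked a b a' b' z'.2 z.2.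
have degt e : deg H (true, e) = ldeg a b a' b' e.
  have pI : injective (pair false : {set V} -> bool * {set V}) by move=> ? ? [].
  rewrite /deg /ldeg -[RHS](card_imset _ pI).
  apply: eq_card => -[[] e']; rewrite inE /H /=.
    by apply/esym/imsetP => -[].
  by apply/idP/imsetP => [h|[e'' + [->]]]; [exists e'; rewrite // inE | rewrite inE].
have degf e : deg H (false, e) = ldeg b a b' a' e.
  have pI : injective (pair true : {set V} -> bool * {set V}) by move=> ? ? [].
  rewrite /deg /ldeg -[RHS](card_imset _ pI).
  apply: eq_card => -[[] e']; rewrite inE /H /=; last first.
    by apply/esym/imsetP => -[].
  rewrite -linkedC.
  by apply/idP/imsetP => [h|[e'' + [->]]]; [exists e'; rewrite // inE | rewrite inE].
apply: le_trans (_ : _ <= prob wt (fun x =>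
    [forall z, forall z', H z z' ==> (x z == x z')])) _.
  apply: prob_le => [|x /andP[/forall_inP ev /forall_inP ev']].
    exact: bit_wt_ge0.
  have agr e e' : linked a b a' b' e e' -> x (true, e) = x (false, e').
    by move=> /exists_inP[d d2 /orP[]/andP[/eqP <- /eqP <-]]; apply/eqP;
      [exact: ev | exact: ev'].
  apply/forallP => -[[] e]; apply/forallP => -[[] e']; rewrite /H //=;
    by apply/implyP => /agr ->.
apply: le_trans (prob_agree p01 q01 r0 r1 rho0 rho1 rE rhoP _ _ _) _.
- by move=> [[] e] [[] e'].
- by move=> [[] e] [[] e'].
- by move=> [[] e]; rewrite ?degt ?degf ldeg_le2.
rewrite -(pair_bigA _ (fun (t : bool) e => deg_bound r rho (deg H (t, e)))) big_bool /=.
under eq_bigr do rewrite degt.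
under [X in _ * X]eq_bigr do rewrite degf.
have B1 := side_bound r0 r1 rho0 rho1 u1 uE aI bI aI' bI'.
have B2 := side_bound r0 r1 rho0 rho1 u1 uE bI aI bI' aI'.
rewrite fixed_partC in B2.
have dge0 c : 0 <= deg_bound r rho c.
  by case: c => [|[|?]] /=; rewrite ?mulr_ge0 ?ltW.
apply: le_trans (ler_pM _ _ B1 B2) _; rewrite ?prodr_ge0 //.
set T := u ^+ _ / rho; rewrite -!exprM (exprD T).
rewrite [(2 * (2 * _))%N]mul2n -addnn exprD.
rewrite [(2 * 'C(#|fixed_part _ _ _ _|, 2))%N]mul2n -addnn exprD invfM.
by rewrite le_eqVlt; apply/orP; left; apply/eqP; ring.
Qed.

Lemma event_perm a b (s : {perm I}) x :
  event [ffun i => a (s i)] [ffun i => b (s i)] x = event a b x.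
Proof.
have imE (c : {ffun I -> V}) (d : {set I}) : [ffun i => c (s i)] @: d = c @: (s @: d).
  by rewrite -imset_comp; apply: eq_imset => i; rewrite ffunE.
have pE (t : {perm I}) (d : {set I}) : (t @: d \in pairs I) = (d \in pairs I).
  by rewrite !inE card_imset //; exact: perm_inj.
apply/forall_inP/forall_inP => [h d d2|h d d2]; last by rewrite !imE h ?pE.
have -> : d = s @: ((s^-1)%g @: d).
  rewrite -imset_comp -[LHS]imset_id; apply: eq_imset => i /=; by rewrite permKV.
by rewrite -!imE h ?pE.
Qed.

Definition matched x :=
  [exists c in [set c : {ffun I -> V} * {ffun I -> V} | injectiveb c.1 && injectiveb c.2],
     event c.1 c.2 x].

Lemma card_inj_pairs :
  #|[set c : {ffun I -> V} * {ffun I -> V} | injectiveb c.1 && injectiveb c.2]|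
  = ((#|V| ^_ #|I|) ^ 2)%N.
Proof.
rewrite -card_inj_ffuns expnS expn1 -cardsX; apply: eq_card => c.
by rewrite !inE.
Qed.

Lemma sum_prob_event :
  \sum_(c in [set c : {ffun I -> V} * {ffun I -> V} | injectiveb c.1 && injectiveb c.2])
     prob wt (event c.1 c.2) = (#|V| ^_ #|I|)%:R ^+ 2 * (r ^+ 2) ^+ 'C(#|I|, 2).
Proof.
rewrite (eq_bigr (fun=> (r ^+ 2) ^+ 'C(#|I|, 2))) => [|c].
  by rewrite sumr_const card_inj_pairs -[LHS]mulr_natl natrX.
by rewrite inE => /andP[/injectiveP ? /injectiveP ?]; rewrite prob_event.
Qed.

(* Precomposing with a permutation turns one matching into [#|I|`!] of them. *)
Lemma prob_matched_le :
  prob wt matched <= (#|V| ^_ #|I|)%:R ^+ 2 * (r ^+ 2) ^+ 'C(#|I|, 2) / (#|I|`!)%:R.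
Proof.
have fact0 : 0 < (#|I|`!)%:R :> R by rewrite ltr0n fact_gt0.
rewrite ler_pdivlMr // -sum_prob_event /prob -expect_sum.
have -> : expect wt (fun x => (matched x)%:R) * (#|I|`!)%:R =
   expect wt (fun x => (matched x)%:R * (#|I|`!)%:R).
  by rewrite /expect mulr_suml; apply: eq_bigr => x _; rewrite mulrA.
apply: expect_le => [|x]; first exact: bit_wt_ge0.
case: (boolP (matched x)) => [|_]; last by rewrite mul0r sumr_ge0.
move=> /exists_inP[[a b]]; rewrite inE /= => /andP[/injectiveP aI /injectiveP bI] ev.
rewrite mul1r -natr_sum ler_nat -big_mkcondr /= sum1dep_card.
pose f (s : {perm I}) := ([ffun i => a (s i)], [ffun i => b (s i)]).
have fI : injective f.
  move=> s s' [/ffunP ss' _]; apply/permP => i; apply: aI.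
  by have := ss' i; rewrite !ffunE.
have -> : (#|I|`! = #|f @: [set: {perm I}]|)%N.
  rewrite card_imset // -cardsT -card_perm; apply: eq_card => s.
  by rewrite [RHS]inE; apply/subsetP => i _; rewrite inE.
apply: subset_leq_card; apply/subsetP => c /imsetP[s _ ->].
rewrite !inE /= event_perm ev andbT; apply/andP.
by split; apply/injectiveP => i j; rewrite !ffunE; [move/aI|move/bI]; apply: perm_inj.
Qed.

(** The bound of [sum_overlap] is the same for every first pair, so summing over first pairs
    multiplies it by the square of the number of injections; this cancels half of the fourth power
    in the squared mean. *)
Lemma prob_unmatched_le : (#|I| <= #|V|)%N ->
  1 - prob wt matched <=
  (\sum_(f < #|I|.+1) ('C(#|I|, f)%:R * ((#|I| ^_ f)%:R * (r ^+ 2) ^- 'C(f, 2) *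
      (#|V|%:R + #|I|%:R * (u ^+ (#|I| + f) / rho)) ^+ (2 * (#|I| - f)))))
  / (#|V| ^_ #|I|)%:R ^+ 2 - 1.
Proof.
move=> mn; set S := \sum_(f < _) _.
have N0 : 0 < (#|V| ^_ #|I|)%:R :> R by rewrite ltr0n ffact_gt0.
have t0 : 0 < (r ^+ 2) ^+ 'C(#|I|, 2) by rewrite !exprn_gt0.
have mu0 : 0 < (#|V| ^_ #|I|)%:R ^+ 2 * (r ^+ 2) ^+ 'C(#|I|, 2).
  by rewrite mulr_gt0 // exprn_gt0.
apply: le_trans (chebyshev_count _ _ mu0 sum_prob_event) _.
- exact: bit_wt_ge0.
- exact: bit_wt_sum1.
rewrite lerD2r ler_pdivrMr ?exprn_gt0 //.
set N := (#|V| ^_ #|I|)%:R in N0 *; set t := (r ^+ 2) ^+ _ in t0 *.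
have -> : S / N ^+ 2 * (N ^+ 2 * t) ^+ 2 = N ^+ 2 * (t ^+ 2 * S).
  by field; rewrite gt_eqF.
rewrite /N -natrX -card_inj_pairs mulr_natl -sumr_const.
apply: ler_sum => -[a b]; rewrite inE /= => /andP[/injectiveP aI /injectiveP bI].
apply: (@le_trans _ _ (t ^+ 2 * (\sum_(a' : {ffun I -> V} | injectiveb a')
    \sum_(b' : {ffun I -> V} | injectiveb b')
    ((fun f => (r ^+ 2) ^- 'C(f, 2)) #|fixed_part a b a' b'| *
     (fun f => u ^+ (#|I| + f) / rho) #|fixed_part a b a' b'| ^+
      ((#|overlap a a'| - #|fixed_part a b a' b'|) +
       (#|overlap b b'| - #|fixed_part a b a' b'|)))))).
  rewrite big_set [X in _ <= _ * X]pair_big /= [X in _ <= X]mulr_sumr.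
  apply: ler_sum => -[a' b'] /= /andP[/injectiveP aI' /injectiveP bI'].
  by rewrite /t -exprM mulnC; exact: prob_event2.
have h0 f : 0 <= (r ^+ 2) ^- 'C(f, 2) by rewrite invr_ge0 !exprn_ge0 // ltW.
have y0 f : 0 <= u ^+ (#|I| + f) / rho.
  by rewrite divr_ge0 ?exprn_ge0 ?(ltW rho0) // (le_trans _ u1).
apply: ler_wpM2l; first by rewrite exprn_ge0 // ltW.
exact: (sum_overlap aI bI h0 y0).
Qed.

End Events.

(* [classical_sets] shadows lemmas on [{set _}] used above. *)
From mathcomp Require Import all_classical all_reals all_analysis.

Import numFieldNormedType.Exports.

(** * Estimates for the second moment *)

Lemma bin_leX (m f : nat) : ('C(m, f) <= m ^ f)%N.
Proof.
elim: f => [|f IH]; first by rewrite bin0.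
have := mul_bin_left m f; rewrite expnS => E.
have : ('C(m, f.+1) <= f.+1 * 'C(m, f.+1))%N by rewrite leq_pmull.
rewrite E => /leq_trans; apply; apply: leq_mul => //; exact: leq_subr.
Qed.

Lemma ffact_leX (m f : nat) : (m ^_ f <= m ^ f)%N.
Proof.
elim: f => [|f IH]; first by rewrite ffactn0.
by rewrite ffactnSr expnSr leq_mul // leq_subr.
Qed.

Section SecondMomentSum.
Variables (R : realType) (K dl A : R) (m n : nat).
Hypotheses (K0 : 0 < K) (dl0 : 0 < dl) (dl1 : dl <= 1) (A1 : 1 <= A).
Hypotheses (m0 : (0 < m)%N) (n0 : (0 < n)%N).
(** The two hypotheses pin [n] to [expR (K * m%:R / 4)] up to a factor of order [sqrt m], as is the
    case near [m_star]. *)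
Hypothesis expm_le : expR (K * m%:R / 4) <= A * n%:R.
Hypothesis n_le : n%:R ^+ 2 <= A * m%:R * expR (K * m%:R / 2).

(* [B f * (1 + x f) ^+ (2 * (m - f))] is the share in E[N^2] / E[N]^2 of the
   pairs with [f] fixed points, and [Einv] is m! / E[N], with the number of
   injections replaced by [n ^ m]. *)
Let tau := expR (- K).
Let y (f : nat) : R := expR ((1 - dl) * K / 4) ^+ (m + f) / expR (- (dl * K / 2)).
Let x (f : nat) : R := m%:R * y f / n%:R.
Let B (f : nat) : R := 'C(m, f)%:R * (m ^_ f)%:R * tau ^- 'C(f, 2) / n%:R ^+ (2 * f).
Let A' := A * expR (dl * K / 2).
Let Einv : R := (m`!)%:R * tau ^- 'C(m, 2) / n%:R ^+ (2 * m).
Let c := dl * K / 8.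
Let mR : R := m%:R.

Let A0 : 0 <= A. Proof. exact: le_trans A1. Qed.
Let mR1 : 1 <= mR. Proof. by rewrite /mR ler1n. Qed.
Let mR0 : 0 <= mR. Proof. by []. Qed.
Let nR0 : 0 < n%:R :> R. Proof. by rewrite ltr0n. Qed.
Let tau0 : 0 < tau. Proof. exact: expR_gt0. Qed.
Let A'1 : 1 <= A'.
Proof.
rewrite /A' -[1]mulr1; apply: ler_pM => //.
by rewrite -expR0 ler_expR; rewrite divr_ge0 // mulr_ge0 // ltW.
Qed.

Lemma inv_n_le : n%:R^-1 <= A * expR (- (K * mR / 4)).
Proof.
by rewrite expRN ler_pdivlMr ?expR_gt0 // mulrC ler_pdivrMr.
Qed.

Let y_E f : y f = expR ((1 - dl) * K / 4 * (m + f)%:R + dl * K / 2).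
Proof. by rewrite /y -expRM_natr expRD expRN invrK. Qed.

Let y0 f : 0 <= y f. Proof. by rewrite y_E expR_ge0. Qed.
Let x0 f : 0 <= x f. Proof. by rewrite /x !mulr_ge0 // invr_ge0. Qed.
Let B0 f : 0 <= B f.
Proof. by rewrite /B !mulr_ge0 ?invr_ge0 ?exprn_ge0 // ltW. Qed.
Let Einv0 : 0 <= Einv.
Proof. by rewrite /Einv !mulr_ge0 ?invr_ge0 ?exprn_ge0 // ltW. Qed.

Let x_le f : x f <= A' * mR * expR (K * f%:R / 4 - dl * K * (m + f)%:R / 4).
Proof.
rewrite /x -[m%:R]/mR y_E.
have -> : A' * mR * expR (K * f%:R / 4 - dl * K * (m + f)%:R / 4) =
  mR * expR ((1 - dl) * K / 4 * (m + f)%:R + dl * K / 2) * (A * expR (- (K * mR / 4))).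
  rewrite /A' [RHS](_ : _ = A * mR *
    (expR ((1 - dl) * K / 4 * (m + f)%:R + dl * K / 2) * expR (- (K * mR / 4))));
    last by ring.
  rewrite [LHS](_ : _ = A * mR *
    (expR (dl * K / 2) * expR (K * f%:R / 4 - dl * K * (m + f)%:R / 4))); last by ring.
  by rewrite -!expRD /mR natrD; congr (_ * expR _); field.
by rewrite ler_wpM2l ?inv_n_le // mulr_ge0 ?expR_ge0.
Qed.

(** Below the cutoff [X] bounds [x f] and [Y] bounds [B f] for [f > 0]; above it [Q] bounds a term
    relative to [Einv]. *)
Let X := A' * mR * expR (- c * mR).
Let Y := A ^+ 2 * mR ^+ 2 * expR (- (K * mR / 4)).
Let Q := 4 * A * A' ^+ 2 * expR (K / 2) * mR ^+ 4 * expR (- (dl * K * mR / 4)).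

Let X0 : 0 <= X.
Proof. by rewrite /X !mulr_ge0 ?expR_ge0 //. Qed.
Let Y0 : 0 <= Y.
Proof. by rewrite /Y !mulr_ge0 ?expR_ge0 ?sqr_ge0. Qed.

(** The cutoff makes [K * f / 4 - dl * K * (m + f) / 4] at most [- c * m]. *)
Lemma small_x f : f%:R <= dl * mR / 2 -> (1 + x f) ^+ (2 * (m - f)) <= expR (2 * (mR * X)).
Proof.
move=> fm; have xX : x f <= X.
  apply: le_trans (x_le f) _; rewrite ler_wpM2l //.
    by rewrite !mulr_ge0 ?expR_ge0.
  rewrite ler_expR /c natrD -[m%:R]/mR.
  have f0 : 0 <= f%:R :> R by [].
  have : 0 <= K * (dl * mR / 2 - f%:R) by rewrite mulr_ge0 ?subr_ge0 // ltW.
  have : 0 <= dl * K * f%:R by rewrite !mulr_ge0 // ltW.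
  lra.
apply: le_trans (_ : (1 + X) ^+ (2 * (m - f)) <= _).
  by apply: lerXn2r; rewrite ?nnegrE ?addr_ge0 // lerD2l.
apply: le_trans (_ : (1 + X) ^+ (2 * m) <= _).
  by apply: ler_weXn2l; rewrite ?lerDl // leq_mul2l leq_subr orbT.
have -> : expR (2 * (mR * X)) = expR X ^+ (2 * m).
  by rewrite -expRM_natr natrM; congr expR; rewrite /mR; ring.
by apply: lerXn2r; rewrite ?nnegrE ?addr_ge0 ?expR_ge0 // expR_ge1Dx.
Qed.

Let bin2R (k : nat) : ('C(k, 2))%:R = k%:R * (k%:R - 1) / 2 :> R.
Proof.
apply: (mulfI (_ : 2 != 0 :> R)) => //.
rewrite -natrM (mul_bin_left k 1) bin1.
case: k => [|k]; first by rewrite mul0r mul0r mulr0.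
by rewrite natrM subn1 /= -[k.+1%:R]natr1; field.
Qed.

Let tauN k : tau ^- 'C(k, 2) = expR (K * (k%:R * (k%:R - 1) / 2)).
Proof. by rewrite /tau -expRM_natr -expRN bin2R mulNr opprK. Qed.

(** Each fixed point contributes at most [m ^+ 2 * n ^- 2 * expR (K * f / 2)], and [f <= m / 2]
    leaves the decay [expR (- (K * m / 4))] of [Y]. *)
Lemma small_B f : (0 < f)%N -> f%:R <= dl * mR / 2 -> Y <= 1 -> B f <= Y.
Proof.
move=> f0 fm Y1.
suff : B f <= Y ^+ f.
  move/le_trans; apply; case: f f0 {fm} => // f _.
  by rewrite exprS ler_piMr // exprn_ile1.
have H : m%:R ^+ 2 * (n%:R^-1) ^+ 2 * expR (K * f%:R / 2) <= Y.
  apply: (@le_trans _ _ (mR ^+ 2 * (A * expR (- (K * mR / 4))) ^+ 2 * expR (K * f%:R / 2))).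
    rewrite ler_wpM2r ?expR_ge0 // ler_wpM2l ?sqr_ge0 //.
    apply: lerXn2r; rewrite ?nnegrE ?invr_ge0 ?inv_n_le //.
    by rewrite mulr_ge0 ?expR_ge0 //.
  rewrite /Y [leLHS](_ : _ = A ^+ 2 * mR ^+ 2 *
    (expR (- (K * mR / 4)) ^+ 2 * expR (K * f%:R / 2))); last by ring.
  rewrite ler_wpM2l ?mulr_ge0 ?sqr_ge0 // -expRM_natr -expRD ler_expR.
  have : 0 <= K * (mR / 2 - f%:R).
    rewrite mulr_ge0 ?(ltW K0) // subr_ge0 (le_trans fm) //.
    by rewrite ler_wpM2r // ler_piMl //.
  lra.
apply: le_trans (_ : (m%:R ^+ 2 * (n%:R^-1) ^+ 2 * expR (K * f%:R / 2)) ^+ f <= _); last first.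
  by apply: lerXn2r; rewrite ?nnegrE //.
rewrite (exprMn _ (_ * _)) (exprMn _ (_ ^+ 2)) -!exprM.
have -> : B f = ('C(m, f)%:R * (m ^_ f)%:R) * n%:R^-1 ^+ (2 * f) * tau ^- 'C(f, 2).
  by rewrite /B exprVn; ring.
apply: ler_pM; rewrite ?mulr_ge0 ?invr_ge0 ?exprn_ge0 ?invr_ge0 ?(ltW tau0) //.
  rewrite ler_wpM2r ?exprn_ge0 ?invr_ge0 // mul2n -addnn exprD -!natrX.
  by apply: ler_pM; rewrite // ler_nat ?bin_leX ?ffact_leX.
rewrite tauN -expRM_natr ler_expR.
have : 0 <= K * f%:R by rewrite mulr_ge0 // ltW.
lra.
Qed.

(** Relative to the term [f = m], each of the [k] points not fixed contributes at most
    [G * (1 + x f) ^+ 2]. Up to polynomial factors [G] is below [expR (- (K * f / 2))] and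
    [x f ^+ 2] below [expR (K * f / 2 - dl * K * m / 2)]; both [G] and [G * x f ^+ 2] thus decay at
    the rate of [Q]. *)
Lemma large_term f : dl * mR / 2 <= f%:R -> (f < m)%N -> Q <= 1 ->
  B f * (1 + x f) ^+ (2 * (m - f)) <= Einv * Q.
Proof.
move=> fm ltfm Q1; have lefm := ltnW ltfm.
have Q0 : 0 <= Q.
  by rewrite /Q !mulr_ge0 ?expR_ge0 ?sqr_ge0 ?exprn_ge0 //; apply: le_trans A1.
set k := (m - f)%N.
have k0 : (0 < k)%N by rewrite subn_gt0.
suff : B f * (1 + x f) ^+ (2 * k) <= Einv * Q ^+ k.
  move/le_trans; apply; rewrite ler_wpM2l //; case: k k0 => // k _.
  by rewrite exprS ler_piMr // exprn_ile1.
pose G := mR * n%:R ^+ 2 * expR (- (K * ((mR + f%:R - 1) / 2))).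
(* The exponent in [G] comes from ['C(m, 2) - 'C(f, 2) = k * (m + f - 1) / 2], and [mR ^+ k] bounds
   ['C(m, f) = 'C(m, k)]. *)
have BG : B f <= Einv * G ^+ k.
  have -> : G ^+ k = mR ^+ k * n%:R ^+ (2 * k) * (tau ^+ 'C(m, 2) * tau ^- 'C(f, 2)).
    rewrite /G (exprMn _ (_ * _)) (exprMn _ mR) -exprM; congr (_ * _).
    rewrite tauN /tau -!expRM_natr -expRD bin2R /k natrB // /mR; congr expR.
    by field.
  have -> : Einv * (mR ^+ k * n%:R ^+ (2 * k) * (tau ^+ 'C(m, 2) * tau ^- 'C(f, 2))) =
     ((m`!)%:R * mR ^+ k) * tau ^- 'C(f, 2) / n%:R ^+ (2 * f).
    rewrite /Einv; have -> : (2 * m = 2 * k + 2 * f)%N by rewrite -mulnDr subnK.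
    rewrite exprD; field.
    by rewrite !expf_neq0 // ?gt_eqF // ltr0n.
  rewrite /B ler_wpM2r ?invr_ge0 ?exprn_ge0 // ler_wpM2r ?invr_ge0 ?exprn_ge0 ?(ltW tau0) //.
  rewrite -natrX -!natrM ler_nat mulnC leq_mul //.
    by rewrite -(ffact_fact lefm) leq_pmulr // fact_gt0.
  by rewrite -bin_sub // bin_leX.
have G0 : 0 <= G by rewrite /G !mulr_ge0 ?expR_ge0 ?exprn_ge0.
apply: le_trans (_ : Einv * G ^+ k * (1 + x f) ^+ (2 * k) <= _).
  by rewrite ler_wpM2r // exprn_ge0 // addr_ge0.
have x01 : 0 <= 1 + x f by rewrite addr_ge0.
rewrite -mulrA ler_wpM2l // exprM -exprMn.
apply: lerXn2r; rewrite ?nnegrE ?mulr_ge0 ?sqr_ge0 //.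
have xx : (1 + x f) ^+ 2 <= 2 + 2 * x f ^+ 2.
  by have := sqr_ge0 (1 - x f); rewrite !expr2; lra.
have x2 : x f ^+ 2 <= A' ^+ 2 * mR ^+ 2 * expR (K * f%:R / 2 - dl * K * mR / 2).
  apply: le_trans (_ : (A' * mR * expR (K * f%:R / 4 - dl * K * (m + f)%:R / 4)) ^+ 2 <= _).
    by apply: lerXn2r; rewrite ?nnegrE ?x_le //; apply: le_trans (x_le f).
  rewrite !exprMn ler_wpM2l ?mulr_ge0 ?sqr_ge0 // -expRM_natr ler_expR natrD -[m%:R]/mR.
  have : 0 <= dl * K * f%:R by rewrite !mulr_ge0 // ltW.
  lra.
have GA : G <= A * mR ^+ 2 * expR (K / 2) * expR (- (K * f%:R / 2)).
  apply: le_trans (_ : mR * (A * m%:R * expR (K * m%:R / 2)) *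
    expR (- (K * ((mR + f%:R - 1) / 2))) <= _).
    by rewrite /G ler_wpM2r ?expR_ge0 // ler_wpM2l //.
  rewrite -[m%:R]/mR [leLHS](_ : _ = A * mR ^+ 2 *
    (expR (K * mR / 2) * expR (- (K * ((mR + f%:R - 1) / 2))))); last by ring.
  rewrite -[leRHS]mulrA -!expRD ler_wpM2l ?mulr_ge0 ?sqr_ge0 // ler_expR; lra.
have xx2 : (1 + x f) ^+ 2 <=
    2 + 2 * (A' ^+ 2 * mR ^+ 2 * expR (K * f%:R / 2 - dl * K * mR / 2)).
  by apply: le_trans xx _; rewrite lerD2l ler_wpM2l.
apply: le_trans (ler_pM G0 (sqr_ge0 _) GA xx2) _.
rewrite [leLHS](_ : _ = A * mR ^+ 2 * expR (K / 2) * (2 * expR (- (K * f%:R / 2)) +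
   2 * A' ^+ 2 * mR ^+ 2 *
     (expR (- (K * f%:R / 2)) * expR (K * f%:R / 2 - dl * K * mR / 2)))); last by ring.
rewrite -expRD.
have e1 : expR (- (K * f%:R / 2)) <= expR (- (dl * K * mR / 4)).
  rewrite ler_expR; have : 0 <= K * (f%:R - dl * mR / 2) by rewrite mulr_ge0 ?subr_ge0 // ltW.
  lra.
have e2 : expR (- (K * f%:R / 2) + (K * f%:R / 2 - dl * K * mR / 2)) <=
    expR (- (dl * K * mR / 4)).
  rewrite ler_expR; have : 0 <= K * dl * mR by rewrite !mulr_ge0 // ltW.
  lra.
have e3 : 1 <= A' ^+ 2 * mR ^+ 2 by rewrite -exprMn exprn_ege1 // mulr_ege1.
have -> : Q = A * mR ^+ 2 * expR (K / 2) *
    (4 * A' ^+ 2 * mR ^+ 2 * expR (- (dl * K * mR / 4))).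
  by rewrite /Q; ring.
rewrite ler_wpM2l ?mulr_ge0 ?sqr_ge0 ?expR_ge0 //.
set e := expR (- (dl * K * mR / 4)) in e1 e2 *.
have ege : 0 <= e by exact: expR_ge0.
have t1 : 2 * expR (- (K * f%:R / 2)) <= 2 * A' ^+ 2 * mR ^+ 2 * e.
  have e3e : e <= A' ^+ 2 * mR ^+ 2 * e by rewrite ler_peMl.
  lra.
have t2 : 2 * A' ^+ 2 * mR ^+ 2 *
    expR (- (K * f%:R / 2) + (K * f%:R / 2 - dl * K * mR / 2)) <=
    2 * A' ^+ 2 * mR ^+ 2 * e.
  by rewrite ler_wpM2l // !mulr_ge0 ?sqr_ge0.
lra.
Qed.

Lemma B_last : B m = Einv.
Proof. by rewrite /B /Einv binn mul1r ffactnn. Qed.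

Lemma normalized_sum_le : Y <= 1 -> Q <= 1 ->
  \sum_(f < m.+1) (B f * (1 + x f) ^+ (2 * (m - f))) <=
  expR (2 * (mR * X)) * (1 + mR * Y) + Einv * (1 + mR * Q).
Proof.
move=> Y1 Q1; have Q0 : 0 <= Q.
  by rewrite /Q !mulr_ge0 ?expR_ge0 ?sqr_ge0 ?exprn_ge0 //; apply: le_trans A1.
rewrite big_ord_recr /= subnn muln0 expr0 mulr1 B_last.
apply: (@le_trans _ _ (expR (2 * (mR * X)) +
    mR * (expR (2 * (mR * X)) * Y + Einv * Q) + Einv)); last first.
  by rewrite le_eqVlt; apply/orP; left; apply/eqP; ring.
rewrite lerD2r -(prednK m0) big_ord_recl /= subn0 (prednK m0).
apply: lerD.
  rewrite /B bin0 ffactn0 /= expr0 muln0 expr0 invr1 !mulr1 mul1r.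
  by have := @small_x 0%N; rewrite subn0; apply; rewrite !mulr_ge0 // ltW // ltW.
apply: (@le_trans _ _ (\sum_(i < m.-1) (expR (2 * (mR * X)) * Y + Einv * Q))).
  apply: ler_sum => i _; rewrite ?/bump ?leq0n ?add1n.
  have im : (i.+1 < m)%N by have := ltn_ord i; rewrite -ltnS prednK.
  have EY : 0 <= expR (2 * (mR * X)) * Y by rewrite mulr_ge0 ?expR_ge0.
  have EQ : 0 <= Einv * Q by rewrite mulr_ge0.
  have [h|h] := leP (i.+1%:R) (dl * mR / 2); last first.
    by rewrite (le_trans (large_term (ltW h) im Q1)) // lerDr.
  rewrite (@le_trans _ _ (expR (2 * (mR * X)) * Y)) ?lerDl // mulrC.
  by rewrite ler_pM ?small_x ?small_B // exprn_ge0 // addr_ge0.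
rewrite sumr_const card_ord -[leLHS]mulr_natl.
apply: ler_wpM2r; last by rewrite ler_nat leq_pred.
by apply: addr_ge0; apply: mulr_ge0; rewrite ?expR_ge0.
Qed.

End SecondMomentSum.

(** * Stirling's formula with explicit error bounds *)

Section Stirling.
Variable R : realType.
Implicit Types x : R.

Lemma ge1_ndecr_ge0 (f f' : R -> R) : f 1 = 0 ->
    (forall x, 0 < x -> is_derive x 1 f (f' x)) -> (forall x, 0 < x -> 0 <= f' x) ->
  forall x, 1 <= x -> 0 <= f x.
Proof.
move=> f1 df df0 x x1; rewrite -f1.
have Df y : 0 < y -> derivable f y 1 by move=> y0; have [] := df y y0.
apply: (@ger0_derive1_ndecry _ f 1) => //.
- move=> y; rewrite in_itv /= andbT => y1; apply: Df; exact: lt_trans y1.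
- move=> y; rewrite in_itv /= andbT => y1.
  have y0 := lt_trans ltr01 y1.
  by rewrite derive1E (@derive_val _ _ _ _ _ _ _ (df y y0)) df0.
- apply: derivable_within_continuous => y; rewrite in_itv /= andbT => y1.
  by apply: Df; exact: lt_le_trans y1.
Qed.

(** At [x = 1 + 1 / m] the approximant equals [1 / (m + 1 / 2)], exactly what makes [stirling_err]
    nonincreasing. *)
Lemma ln_ge_pade x : 1 <= x -> 2 * (x - 1) / (x + 1) <= ln x.
Proof.
move=> x1; rewrite -subr_ge0.
apply: (@ge1_ndecr_ge0 (fun y => ln y - 2 * (y - 1) / (y + 1))
   (fun y => (y - 1) ^+ 2 / (y * (y + 1) ^+ 2))) => // [|y y0|y y0].
- by rewrite ln1 subrr mulr0 mul0r subr0.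
- have y10 : y + 1 != 0 by rewrite gt_eqF // addr_gt0.
  have H := is_derive1_ln y0.
  have -> : (y - 1) ^+ 2 / (y * (y + 1) ^+ 2) = y^-1 - 4 / (y + 1) ^+ 2.
    by field; rewrite y10 gt_eqF.
  apply: is_deriveB.
  have V : is_derive y 1 (fun y : R => (y + 1)^-1) (- (y + 1) ^- 2).
    have D : is_derive y 1 (fun y : R => y + 1) 1.
      by apply: is_derive_eq (addr0 _).
    apply: is_derive_eq (is_deriveV _ _) _ => //.
    by rewrite /GRing.scale /= mulr1.
  have M : is_derive y 1 (fun y : R => 2 * (y - 1)) 2.
    by apply: is_derive_eq; rewrite /GRing.scale /= subr0 mulr1.
  apply: is_derive_eq; rewrite /GRing.scale /=; by field.
- by rewrite divr_ge0 ?sqr_ge0 // mulr_ge0 ?sqr_ge0 // ltW.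
Qed.

(** With [x = expR t] this is [t <= sinh t]; at [x = 1 + 1 / m] it yields a telescoping
    remainder. *)
Lemma ln_le_sinh x : 1 <= x -> ln x <= (x - x^-1) / 2.
Proof.
move=> x1; rewrite -subr_ge0.
apply: (@ge1_ndecr_ge0 (fun y => (y - y^-1) / 2 - ln y)
   (fun y => (1 - y^-1) ^+ 2 / 2)) => // [|y y0|y y0].
- by rewrite ln1 invr1 subrr mul0r subr0.
- have H := is_derive1_ln y0.
  have yn0 : y != 0 by rewrite gt_eqF.
  have V : is_derive y 1 (fun y : R => y^-1) (- y ^- 2).
    apply: is_derive_eq (is_deriveV _ _) _ => //.
    by rewrite /GRing.scale /= mulr1.
  apply: is_derive_eq; rewrite /GRing.scale /=; by field.
- by rewrite divr_ge0 ?sqr_ge0.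
Qed.

Definition stirling_err (m : nat) : R :=
  ln (m`!)%:R - ((m%:R + 1 / 2) * ln m%:R - m%:R).

Lemma stirling_step (m : nat) : (0 < m)%N ->
  0 <= stirling_err m - stirling_err m.+1 <= (m%:R^-1 - m.+1%:R^-1) / 4.
Proof.
move=> m0; have mR : 0 < m%:R :> R by rewrite ltr0n.
have m1R : 0 < m.+1%:R :> R by rewrite ltr0n.
have f0 : 0 < (m`!)%:R :> R by rewrite ltr0n fact_gt0.
set x : R := m.+1%:R / m%:R.
have lx : ln m.+1%:R = ln m%:R + ln x.
  by rewrite /x ln_div ?posrE // addrC subrK.
have x1 : 1 <= x by rewrite ler_pdivlMr // mul1r ler_nat.
have -> : stirling_err m - stirling_err m.+1 = (m%:R + 1 / 2) * ln x - 1.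
  rewrite /stirling_err factS natrM lnM ?posrE // lx -natr1; ring.
have xE : x = 1 + m%:R^-1 by rewrite /x -natr1; field; rewrite gt_eqF.
have L := ln_ge_pade x1; have U := ln_le_sinh x1.
have mh : 0 < m%:R + 1 / 2 :> R by rewrite addr_gt0.
apply/andP; split.
  have -> : 0 = (m%:R + 1 / 2) * (2 * (x - 1) / (x + 1)) - 1 :> R.
    rewrite xE; field; rewrite gt_eqF //=; rewrite gt_eqF // ?addr_gt0 //; lra.
  by rewrite lerD2r ler_pM2l.
apply: (@le_trans _ _ ((m%:R + 1 / 2) * ((x - x^-1) / 2) - 1)).
  by rewrite lerD2r ler_pM2l.
rewrite le_eqVlt; apply/orP; left; apply/eqP; rewrite /x -natr1; field.
by rewrite nat1r !gt_eqF.
Qed.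

(** The error starts at 1 for [m = 1] and decreases; its decrements telescope to a total loss of at
    most 1/4, which is tracked by the invariant [3 / 4 + m^-1 / 4]. *)
Lemma stirling_bound (m : nat) : (0 < m)%N -> 3 / 4 <= stirling_err m <= 1.
Proof.
case: m => // m _.
have e1 : stirling_err 1 = 1 by rewrite /stirling_err /= ln1; ring.
suff : 3 / 4 + (m.+1%:R)^-1 / 4 <= stirling_err m.+1 <= 1.
  move=> /andP[h ->]; rewrite andbT; apply: le_trans h.
  by rewrite lerDl divr_ge0 // invr_ge0.
elim: m => [|m /andP[l u]].
  by rewrite e1 invr1 lexx andbT; lra.
have := @stirling_step m.+1 isT; move: l u.
set a := m.+1%:R^-1; set b := m.+2%:R^-1; set s := stirling_err _.
by set s' := stirling_err _ => l u /andP[h1 h2]; apply/andP; split; lra.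
Qed.

End Stirling.

(** * Second moment ratio for large m *)

Section Asymptotics.
Variable R : realType.
Implicit Types (K dl A : R) (m n : nat).

Lemma exp_decay (k : nat) (a c e : R) : 0 <= a -> 0 < c -> 0 < e ->
  exists T : nat, forall m : nat, (T <= m)%N -> a * m%:R ^+ k * expR (- (c * m%:R)) <= e.
Proof.
move=> a0 c0 e0; pose D := a * (k.+1`!)%:R / c ^+ k.+1 / e.
have [T TD] : exists T : nat, D <= T%:R.
  exists (Num.trunc D).+1; exact/ltW/truncnS_gt.
exists T.+1 => m Tm; have m0 : 0 < m%:R :> R by rewrite ltr0n (leq_trans _ Tm).
have f0 : 0 < (k.+1`!)%:R :> R by rewrite ltr0n fact_gt0.
have cm0 : 0 <= c * m%:R by rewrite mulr_ge0 // ltW.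
have H := expR_ge1Dxn k cm0.
rewrite expRN ler_pdivrMr ?expR_gt0 //.
apply: (@le_trans _ _ (e * ((c * m%:R) ^+ k.+1 / (k.+1`!)%:R))); last first.
  by rewrite ler_wpM2l ?(ltW e0) // (le_trans _ H) // lerDr.
have -> : e * ((c * m%:R) ^+ k.+1 / (k.+1`!)%:R) =
   (e * c ^+ k.+1 * m%:R / (k.+1`!)%:R) * m%:R ^+ k.
  by rewrite exprMn [m%:R ^+ k.+1]exprS; ring.
rewrite ler_wpM2r ?exprn_ge0 // ler_pdivlMr //.
have : D <= m%:R by rewrite (le_trans TD) // ler_nat ltnW.
rewrite /D ler_pdivrMr // ler_pdivrMr ?exprn_gt0 // => /le_trans; apply.
by rewrite le_eqVlt; apply/orP; left; apply/eqP; ring.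
Qed.

Lemma ffact_ge m n : (m <= n)%N -> (0 < n)%N ->
  n%:R ^+ m * (1 - m%:R ^+ 2 / n%:R) <= (n ^_ m)%:R :> R.
Proof.
move=> mn n0; have nR : 0 < n%:R :> R by rewrite ltr0n.
elim: m mn => [|m IH] mn; first by rewrite expr0 expr2 !mul0r subr0 mulr1.
have {}IH := IH (ltnW mn).
rewrite ffactnSr natrM natrB; last exact: ltnW.
have mnR : m%:R <= n%:R :> R by rewrite ler_nat ltnW.
apply: le_trans (ler_wpM2r _ IH); last by rewrite subr_ge0.
have -> : n%:R ^+ m * (1 - m%:R ^+ 2 / n%:R) * (n%:R - m%:R) =
  n%:R ^+ m.+1 * ((1 - m%:R ^+ 2 / n%:R) * (1 - m%:R / n%:R)) :> R.
  by rewrite [n%:R ^+ m.+1]exprS; field; rewrite gt_eqF.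
rewrite ler_wpM2l ?exprn_ge0 //.
have a0 : 0 <= m%:R ^+ 2 / n%:R :> R by rewrite divr_ge0.
have b0 : 0 <= m%:R / n%:R :> R by rewrite divr_ge0.
have i0 : 0 <= n%:R^-1 :> R by rewrite invr_ge0.
have -> : m.+1%:R ^+ 2 / n%:R = m%:R ^+ 2 / n%:R + 2 * (m%:R / n%:R) + n%:R^-1 :> R.
  by rewrite -natr1; ring.
nra.
Qed.

Lemma expR_le_linear (w z : R) : 0 < w -> w <= 1 / 4 -> z <= 2 * w ->
  expR z <= 1 + 4 * w.
Proof.
move=> w0 w1 zw.
have h : 1 - 2 * w <= expR (- z) by apply: le_trans (expR_ge1Dx _); lra.
have eg := expR_gt0 z; move: h; rewrite expRN => h.
have : (1 - 2 * w) * expR z <= 1 by rewrite -ler_pdivlMr // mul1r.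
move: (expR z) eg {h} => t; nra.
Qed.

(** The factor [(1 - w) ^+ 2] is the price of replacing [n ^_ m] by [n ^ m] in the squared mean; 20
    leaves room for it on all of [w <= 1 / 4]. *)
Lemma ratio_arith (w e E a b S : R) : 0 < w -> w <= 1 / 4 ->
    0 <= e -> e <= 1 + 4 * w -> 0 <= E -> E <= w -> 0 <= a -> a <= w -> 0 <= b -> b <= w ->
    S <= e * (1 + a) + E * (1 + b) ->
  S <= (20 * w + 1) * (1 - w) ^+ 2.
Proof.
move=> w0 w1 e0 e1 E0 E1 a0 a1 b0 b1 hS.
have h1 : e * (1 + a) <= (1 + 4 * w) * (1 + w) by apply: ler_pM => //; lra.
have h2 : E * (1 + b) <= w * (1 + w) by apply: ler_pM => //; lra.
apply: le_trans hS _; apply: le_trans (lerD h1 h2) _; nra.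
Qed.

Lemma second_moment_ratio K dl A (w : R) :
    0 < K -> 0 < dl -> dl <= 1 -> 1 <= A -> 0 < w -> w <= 1 / 4 ->
  exists T : nat, forall m n, (T <= m)%N -> (0 < n)%N ->
    expR (K * m%:R / 4) <= A * n%:R ->
    n%:R ^+ 2 <= A * m%:R * expR (K * m%:R / 2) ->
    (m`!)%:R * expR (- K) ^- 'C(m, 2) / n%:R ^+ (2 * m) <= w ->
  (m <= n)%N /\
  (\sum_(f < m.+1) ('C(m, f)%:R * ((m ^_ f)%:R * expR (- K) ^- 'C(f, 2) *
     (n%:R + m%:R * (expR ((1 - dl) * K / 4) ^+ (m + f) / expR (- (dl * K / 2))))
       ^+ (2 * (m - f))))) / (n ^_ m)%:R ^+ 2 - 1 <= 20 * w.
Proof.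
move=> K0 dl0 dl1 A1 w0 w1; have A0 : 0 <= A := le_trans ler01 A1.
have A'0 : 0 <= A * expR (dl * K / 2) by rewrite mulr_ge0 ?expR_ge0.
(* The first three thresholds make [m * X], [m * Y] and [m * Q] small, hence one power of [m] more
   than in [X], [Y], [Q]; the fourth makes [m ^+ 2 / n] small. *)
have [T1 H1] := @exp_decay 2 _ (dl * K / 8) w A'0 ltac:(by rewrite divr_gt0 // mulr_gt0) w0.
have [T2 H2] := @exp_decay 3 (A ^+ 2) (K / 4) w (sqr_ge0 _) ltac:(by rewrite divr_gt0) w0.
have [T3 H3] := @exp_decay 5 (4 * A * (A * expR (dl * K / 2)) ^+ 2 * expR (K / 2))
  (dl * K / 4) w ltac:(by rewrite !mulr_ge0 ?sqr_ge0 ?expR_ge0)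
  ltac:(by rewrite divr_gt0 // mulr_gt0) w0.
have [T4 H4] := @exp_decay 2 A (K / 4) w A0 ltac:(by rewrite divr_gt0) w0.
exists (T1 + T2 + T3 + T4).+1 => m n Tm n0 h1 h2 hE.
have [m1 m2 m3 m4 m0] : [/\ (T1 <= m)%N, (T2 <= m)%N, (T3 <= m)%N, (T4 <= m)%N & (0 < m)%N].
  by clear -Tm; split; lia.
have {}H1 := H1 m m1; have {}H2 := H2 m m2.
have {}H3 := H3 m m3; have {}H4 := H4 m m4.
have mR : 1 <= m%:R :> R by rewrite ler1n.
have nR : 0 < n%:R :> R by rewrite ltr0n.
have w_1 : w <= 1 by apply: le_trans w1 _; rewrite ler_pdivrMr // mul1r ler1n.
have Hn : m%:R ^+ 2 / n%:R <= w.
  apply: le_trans H4; apply: le_trans (ler_wpM2l (sqr_ge0 m%:R) (inv_n_le n0 h1)) _.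
  rewrite le_eqVlt; apply/orP; left; apply/eqP.
  by rewrite (_ : K / 4 * m%:R = K * m%:R / 4); ring.
have mn : (m <= n)%N.
  have : m%:R ^+ 2 <= n%:R :> R.
    by move: Hn; rewrite ler_pdivrMr // => /le_trans; apply; rewrite ler_piMl.
  rewrite -natrX ler_nat; by apply: leq_trans; rewrite expnS expn1 leq_pmulr.
split=> //.
set X := A * expR (dl * K / 2) * m%:R * expR (- (dl * K / 8) * m%:R).
set Y := A ^+ 2 * m%:R ^+ 2 * expR (- (K * m%:R / 4)).
set Q := 4 * A * (A * expR (dl * K / 2)) ^+ 2 * expR (K / 2) * m%:R ^+ 4 *
  expR (- (dl * K * m%:R / 4)).
have X0 : 0 <= X by rewrite /X !mulr_ge0 ?expR_ge0.
have Y0 : 0 <= Y by rewrite /Y !mulr_ge0 ?expR_ge0.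
have Q0 : 0 <= Q by rewrite /Q !mulr_ge0 ?expR_ge0 ?sqr_ge0 ?exprn_ge0.
have mX : m%:R * X <= w.
  apply: le_trans H1; rewrite le_eqVlt; apply/orP; left; apply/eqP.
  by rewrite /X mulNr; ring.
have mY : m%:R * Y <= w.
  apply: le_trans H2; rewrite le_eqVlt; apply/orP; left; apply/eqP.
  by rewrite /Y (_ : K / 4 * m%:R = K * m%:R / 4); ring.
have mQ : m%:R * Q <= w.
  apply: le_trans H3; rewrite le_eqVlt; apply/orP; left; apply/eqP.
  by rewrite /Q (_ : dl * K / 4 * m%:R = dl * K * m%:R / 4); ring.
have Y1 : Y <= 1 by apply: le_trans w_1; apply: le_trans mY; rewrite ler_peMl.
have Q1 : Q <= 1 by apply: le_trans w_1; apply: le_trans mQ; rewrite ler_peMl.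
have N := normalized_sum_le K0 dl0 dl1 A1 m0 n0 h1 h2 Y1 Q1.
set E := (m`!)%:R * _ / _ in hE N.
have E0 : 0 <= E by rewrite /E !mulr_ge0 ?invr_ge0 ?exprn_ge0 ?expR_ge0.
set S := \sum_(f < m.+1) _ in N; set S' := \sum_(f < m.+1) _.
have SS : S' = n%:R ^+ (2 * m) * S.
  rewrite /S /S' mulr_sumr; apply: eq_bigr => f _.
  set yf := _ / expR (- _).
  have -> : n%:R + m%:R * yf = n%:R * (1 + m%:R * yf / n%:R).
    by field; rewrite gt_eqF.
  rewrite exprMn; have -> : (2 * m = 2 * f + 2 * (m - f))%N.
    by rewrite -mulnDr subnKC // -ltnS.
  rewrite [n%:R ^+ (2 * f + _)]exprD; field.
  by rewrite !expf_neq0 // gt_eqF // expR_gt0.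
have F := ffact_ge mn n0.
have nm0 : 0 < n%:R ^+ m :> R by rewrite exprn_gt0.
have F2 : n%:R ^+ (2 * m) * (1 - w) ^+ 2 <= (n ^_ m)%:R ^+ 2.
  rewrite mulnC exprM -exprMn; have w10 : 0 <= 1 - w by rewrite subr_ge0.
  apply: lerXn2r; [by rewrite nnegrE mulr_ge0 // ltW | by rewrite nnegrE |].
  by apply: le_trans F; rewrite ler_wpM2l ?(ltW nm0) // lerD2l lerN2.
rewrite lerBlDr ler_pdivrMr ?exprn_gt0 ?ltr0n ?ffact_gt0 //.
have w200 : 0 <= 20 * w + 1 by rewrite addr_ge0 // mulr_ge0 // ltW.
apply: le_trans (ler_wpM2l w200 F2).
rewrite SS mulrCA ler_wpM2l ?exprn_ge0 //.
have e2 := expR_le_linear w0 w1 (ler_wpM2l (ler0n _ 2) mX).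
have mY0 : 0 <= m%:R * Y by apply: mulr_ge0.
have mQ0 : 0 <= m%:R * Q by apply: mulr_ge0.
exact: ratio_arith w0 w1 (expR_ge0 _) e2 E0 hE mY0 mY mQ0 mQ N.
Qed.

End Asymptotics.

Local Open Scope classical_set_scope.

(** * The function W and the window around its solution *)

Section Window.
Variables (R : realType) (p q : R).
Hypotheses (p01 : 0 < p < 1) (q01 : 0 < q < 1).

Let K := - ln (tau p q).
Let la := lambda p q.

Lemma tau_gt0 : 0 < tau p q.
Proof.
move/andP: p01 => [? ?]; move/andP: q01 => [? ?].
by rewrite /tau /tau_ !expr1 addr_gt0 // mulr_gt0 // subr_gt0.
Qed.

Lemma tau_lt1 : tau p q < 1.
Proof.
move/andP: p01 => [? ?]; move/andP: q01 => [? ?].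
by rewrite /tau /tau_ !expr1; nra.
Qed.

Lemma rate_gt0 : 0 < K.
Proof. by rewrite /K oppr_gt0 ln_lt0 // tau_gt0 tau_lt1. Qed.

Lemma tau_exp : tau p q = expR (- K).
Proof. by rewrite /K opprK lnK // posrE tau_gt0. Qed.

Lemma lambdaE : la = K^-1.
Proof. by rewrite /la /lambda !div1r lnV // posrE tau_gt0. Qed.

Let la0 : 0 < la. Proof. by rewrite lambdaE invr_gt0 rate_gt0. Qed.

Let la_ge0 : 0 <= la. Proof. exact: ltW. Qed.

Let ln_2pi_ge0 (x : R) : 1 <= x -> 0 <= ln (2 * pi * x).
Proof.
move=> x1; apply: ln_ge0; have := pi_ge2 R; nra.
Qed.

Lemma Wfun_ge (x : R) : 1 <= x -> x <= Wfun p q x.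
Proof.
move=> x1; have x0 : 0 < x by rewrite (lt_le_trans _ x1).
rewrite /Wfun -/la -addrA lerDl; apply: addr_ge0; apply: mulr_ge0.
- by rewrite mulr_ge0 // ltW.
- exact: ln_ge0.
- by rewrite divr_ge0 // ltW.
- exact: ln_2pi_ge0.
Qed.

Lemma Wfun_continuous (b : R) : {within `[1, b], continuous (Wfun p q)}.
Proof.
apply: derivable_within_continuous => x; rewrite in_itv /= => /andP[x1 _].
have x0 : 0 < x by rewrite (lt_le_trans _ x1).
have pi0 : 0 < 2 * pi * x by rewrite mulr_gt0 // mulr_gt0 // pi_gt0.
have H := is_derive1_ln x0.
have xn0 : x != 0 by rewrite gt_eqF.
have V : is_derive x 1 (fun y : R => y^-1) (- x ^- 2).
  apply: is_derive_eq (is_deriveV _ _) _ => //.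
  by rewrite /GRing.scale /= mulr1.
have M : is_derive x 1 (fun y : R => 2 * pi * y) (2 * pi).
  by apply: is_derive_eq; rewrite /GRing.scale /= mulr1.
have L : is_derive x 1 (fun y : R => ln (2 * pi * y)) ((2 * pi * x)^-1 * (2 * pi)).
  exact: (@is_derive1_comp _ (@ln R) (fun y : R => 2 * pi * y) x _ _ (is_derive1_ln pi0) M).
rewrite /Wfun; apply: ex_derive.
Qed.

Lemma m_starP (n : nat) : pi <= 2 * ln n%:R :> R ->
  1 <= m_star p q n /\
  Wfun p q (m_star p q n) = 4 * la * ln n%:R + 2 * la + 1.
Proof.
move=> hn; set v := 4 * la * ln n%:R + 2 * la + 1.
have pi2 := pi_ge2 R.
have v1 : 1 <= v by rewrite /v; have := la0; nra.
suff ex : [set x : R | 1 <= x /\ Wfun p q x = v] !=set0 by have [] := getPex ex.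
have W1 : Wfun p q 1 <= v.
  rewrite /Wfun ln1 mulr0 addr0 divr1 mulr1 /v.
  have : ln (2 * pi) <= 2 * pi :> R by rewrite ltW // ln_sublinear; lra.
  have := la0; rewrite -/la; nra.
have Wv := Wfun_ge v1.
have [|c] := @IVT R (Wfun p q) 1 v v v1 (@Wfun_continuous v).
  by rewrite ge_min W1 /= le_max Wv orbT.
by rewrite in_itv /= => /andP[c1 _] cv; exists c.
Qed.

Section Equation.
Variables (x L : R).
Hypotheses (x1 : 1 <= x) (L0 : 0 <= L).
Hypothesis xE : Wfun p q x = 4 * la * L + 2 * la + 1.

Lemma window_upper : x <= 4 * la * L + 2 * la + 1.
Proof. by rewrite -xE Wfun_ge. Qed.

Lemma window_lower : 4 * la * L + 2 * la + 1 <= x + 2 * la * ln x + 2 * la * pi.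
Proof.
rewrite -xE /Wfun -/la lerD2l.
have x0 : 0 < x by rewrite (lt_le_trans _ x1).
have pi2 := pi_ge2 R.
have pix : 0 < 2 * pi * x by rewrite mulr_gt0 // mulr_gt0 // pi_gt0.
have h : ln (2 * pi * x) <= 2 * pi * x by rewrite ltW // ln_sublinear.
have lx : 0 <= la / x by rewrite divr_ge0 // ltW.
apply: le_trans (ler_wpM2l lx h) _.
by rewrite le_eqVlt; apply/orP; left; apply/eqP; field; rewrite gt_eqF.
Qed.

(** The inequality [ln t <= t] at [t = x / (2 * la)] absorbs the logarithm into a second copy of
    [x]; the factor 2 lost still leaves linear growth of [m_star] in [log n]. *)
Lemma window_linear : 4 * la * L + 2 * la + 1 <= 2 * x + 2 * la * ln (2 * la) + 2 * la * pi.
Proof.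
apply: le_trans window_lower _; rewrite lerD2r.
have x0 : 0 < x by rewrite (lt_le_trans _ x1).
have a0 : 0 < 2 * la by rewrite mulr_gt0.
have : ln (x / (2 * la)) <= x / (2 * la) by rewrite ltW // ln_sublinear // divr_gt0.
rewrite ln_div ?posrE // => /(ler_wpM2l (ltW a0)).
have -> : 2 * la * (x / (2 * la)) = x by field; rewrite gt_eqF.
rewrite mulrBr; lra.
Qed.

End Equation.

(** Only the last term of [W] can decrease, through its factor [la / x]; by
    [ln (2 * pi * x) <= 2 * pi * x] this loses at most [(y - x) * (2 * la * pi / y)], half of the
    gain [y - x] of the first term. *)
Lemma Wfun_diff (x y : R) : 1 <= x -> x <= y -> 4 * la * pi <= y ->
  (y - x) / 2 <= Wfun p q y - Wfun p q x.
Proof.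
move=> x1 xy yb; have x0 : 0 < x by rewrite (lt_le_trans _ x1).
have y0 : 0 < y by rewrite (lt_le_trans x0 xy).
have pi0 : 0 < pi :> R := pi_gt0 R.
have px : 0 < 2 * pi * x by rewrite !mulr_gt0.
have py : 0 < 2 * pi * y by rewrite !mulr_gt0.
have l1 : ln x <= ln y by rewrite ler_ln ?posrE.
have l2 : ln (2 * pi * x) <= ln (2 * pi * y).
  by rewrite ler_ln ?posrE // ler_pM2l // mulr_gt0.
have l3 : ln (2 * pi * x) <= 2 * pi * x by rewrite ltW // ln_sublinear.
rewrite /Wfun -/la.
have d1 : 0 <= 2 * la * (ln y - ln x).
  by apply: mulr_ge0; [exact: mulr_ge0 | rewrite subr_ge0].
have d2 : 0 <= la / y * (ln (2 * pi * y) - ln (2 * pi * x)).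
  by apply: mulr_ge0; [exact: divr_ge0 (ltW y0) | rewrite subr_ge0].
have d3 : la * (y - x) / (x * y) * ln (2 * pi * x) <= (y - x) / 2.
  apply: (@le_trans _ _ (la * (y - x) / (x * y) * (2 * pi * x))).
    apply: ler_wpM2l => //; apply: divr_ge0; last exact/ltW/mulr_gt0.
    by apply: mulr_ge0; rewrite ?subr_ge0.
  have -> : la * (y - x) / (x * y) * (2 * pi * x) = (y - x) * (2 * la * pi / y).
    by field; rewrite !gt_eqF.
  by rewrite ler_wpM2l ?subr_ge0 // ler_pdivrMr //; lra.
have e3 : la * (y - x) / (x * y) * ln (2 * pi * x) =
  la / x * ln (2 * pi * x) - la / y * ln (2 * pi * x).
  by field; rewrite !gt_eqF.
rewrite e3 in d3; rewrite mulrBr in d1; rewrite mulrBr in d2; lra.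
Qed.

(** By Stirling, [m * K / 2 * W m] collects [K * m ^+ 2 / 2], [m * ln m] and [ln (2 * pi * m) / 2],
    while the value at [x] supplies [2 * m * ln n + m + m * K / 2]. This is where the shape of [W]
    comes from. *)
Lemma first_moment_exponent (m n : nat) (x : R) : (0 < m)%N -> (0 < n)%N ->
    Wfun p q x = 4 * la * ln n%:R + 2 * la + 1 ->
  (m`!)%:R * expR (- K) ^- 'C(m, 2) / n%:R ^+ (2 * m) =
  expR (m%:R * K / 2 * (Wfun p q m%:R - Wfun p q x) + stirling_err R m - ln (2 * pi) / 2).
Proof.
move=> m0 n0 xE; have mR : 0 < m%:R :> R by rewrite ltr0n.
have nR : 0 < n%:R :> R by rewrite ltr0n.
have fR : 0 < (m`!)%:R :> R by rewrite ltr0n fact_gt0.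
have b2 : ('C(m, 2))%:R = m%:R * (m%:R - 1) / 2 :> R.
  apply: (mulfI (_ : 2 != 0 :> R)) => //.
  by rewrite -natrM (mul_bin_left m 1) bin1 natrM natrB //; field.
have -> : (m`!)%:R * expR (- K) ^- 'C(m, 2) / n%:R ^+ (2 * m) =
   expR (ln (m`!)%:R) * expR (- K) ^- 'C(m, 2) / expR (ln n%:R) ^+ (2 * m).
  by rewrite !lnK ?posrE.
rewrite -!expRM_natr -!expRN -!expRD; congr expR.
rewrite natrM b2 xE /Wfun /stirling_err -/la lambdaE lnM ?posrE //; last first.
  by rewrite mulr_gt0 // pi_gt0.
have K0 := rate_gt0.
by field; rewrite !gt_eqF.
Qed.

End Window.

(** * Random graphs *)

HB.instance Definition _ (V : finType) := [isSub for @edges V].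
HB.instance Definition _ (V : finType) := [Equality of sgraph V by <:].
HB.instance Definition _ (V : finType) := [Choice of sgraph V by <:].
HB.instance Definition _ (V : finType) := [Countable of sgraph V by <:].
HB.instance Definition _ (V : finType) := [Finite of sgraph V by <:].

Section Matchings.
Variables (V W : finType).

Lemma adj_induced (g : sgraph V) (A : {set V}) (x y : {x | x \in A}) :
  adj (Defs.induced g A) x y = adj g (val x) (val y).
Proof. by rewrite /adj inE imsetU1 imset_set1. Qed.

Lemma adjxx (g : sgraph V) x : adj g x x = false.
Proof.
apply/negP => /(forall_inP (edges_card2 g)).
by rewrite finset.setUid cards1.
Qed.

End Matchings.

(** An enumeration of [A] gives [a], and its composite with the isomorphism gives [b]; conversely
    the images of [a] and [b] carry the isomorphism. *)
Lemma m_isomorphicP (V W : finType) (m : nat) (g : sgraph V) (h : sgraph W) :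
  m_isomorphic m g h <->
  exists (a : {ffun 'I_m -> V}) (b : {ffun 'I_m -> W}),
    [/\ injective a, injective b &
        forall d, d \in pairs 'I_m -> (a @: d \in edges g)%SET = (b @: d \in edges h)%SET].
Proof.
split.
  move=> [A [B [cA cB [f [fbij fE]]]]].
  have e : m = #|{: {x | x \in A}}| by rewrite card_sig cA.
  pose al (i : 'I_m) : {x | x \in A} := enum_val (cast_ord e i).
  have alI : injective al by move=> i j /enum_val_inj /cast_ord_inj.
  exists [ffun i => val (al i)], [ffun i => val (f (al i))]; split.
  - by move=> i j; rewrite !ffunE => /val_inj /alI.
  - by move=> i j; rewrite !ffunE => /val_inj /(bij_inj fbij) /alI.
  - move=> d; rewrite inE => /cards2P[i [j [ij ->]]].
    rewrite !imsetU1 !imset_set1 !ffunE.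
    by have := fE (al i) (al j); rewrite !adj_induced.
move=> [a [b [aI bI ab]]].
exists (a @: [set: 'I_m])%SET, (b @: [set: 'I_m])%SET; split.
- by rewrite card_imset // cardsT card_ord.
- by rewrite card_imset // cardsT card_ord.
have ex (x : {x | x \in (a @: [set: 'I_m])%SET}) : exists i, val x == a i.
  by have /imsetP[i _ ->] := valP x; exists i.
have bT i : b i \in (b @: [set: 'I_m])%SET by rewrite imset_f // inE.
pose f (x : {x | x \in (a @: [set: 'I_m])%SET}) : {x | x \in (b @: [set: 'I_m])%SET} :=
  exist _ (b (xchoose (ex x))) (bT _).
have fE x : val x = a (xchoose (ex x)) by exact/eqP/(xchooseP (ex x)).
exists f; split.
  apply: inj_card_bij; last by rewrite !card_sig !card_imset.
  by move=> x y [] /bI xy; apply: val_inj; rewrite !fE xy.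
move=> x y; rewrite !adj_induced /=; have := fE y; have := fE x.
move: (xchoose (ex x)) (xchoose (ex y)) => i j /= -> ->.
have [->|ij] := eqVneq i j; first by rewrite !adjxx.
have := ab [set i; j]%SET.
by rewrite [_ \in pairs _]inE cards2 ij !imsetU1 !imset_set1 => /(_ isT).
Qed.

(** * Random graphs as functions of independent bits *)

Section Coding.
Variables (R : realType) (n : nat) (p q : R).
Hypotheses (p01 : 0 < p < 1) (q01 : 0 < q < 1).

Let wt := bit_wt (@fst bool {set 'I_n}) p q.

Lemma side_edges_card2 (x : {ffun bool * {set 'I_n} -> bool}) c :
  [forall e in [set e in pairs 'I_n | x (c, e)]%SET, #|e| == 2%N].
Proof. by apply/forall_inP => e; rewrite !inE => /andP[]. Qed.

(** Bits are indexed by all subsets of the vertices; those at sets not of size 2 are ignored. *)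
Definition side_graph x c : sgraph 'I_n := SGraph (side_edges_card2 x c).

Lemma prob_side_graphs (g h : sgraph 'I_n) :
  prob wt (fun x => (side_graph x true == g) && (side_graph x false == h)) =
  gnp_pmf p g * gnp_pmf q h.
Proof.
pose C : {set bool * {set 'I_n}} := [set z : bool * {set 'I_n} | #|z.2| == 2%N]%SET.
pose y (z : bool * {set 'I_n}) := z.2 \in edges (if z.1 then g else h).
have E x : (side_graph x true == g) && (side_graph x false == h) =
    [forall z in C, x z == y z].
  have key c (k : sgraph 'I_n) : (side_graph x c == k) =
      [forall e in pairs 'I_n, x (c, e) == (e \in edges k)].
    rewrite -val_eqE /=; apply/eqP/forall_inP => [<- e e2|H].
      by rewrite inE e2.
    apply/setP => e; rewrite inE; case: (boolP (e \in pairs 'I_n)) => [/H/eqP //|e2].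
    apply/esym/negbTE; apply: contra e2 => /(forall_inP (edges_card2 k)).
    by rewrite inE.
  rewrite !key; apply/andP/forall_inP => [[/forall_inP Ht /forall_inP Hf] [[] e]|H].
  - by rewrite inE /= => e2; apply: Ht; rewrite inE.
  - by rewrite inE /= => e2; apply: Hf; rewrite inE.
  - by split; apply/forall_inP => e; rewrite inE => e2;
      [apply: (H (true, e)) | apply: (H (false, e))]; rewrite inE.
rewrite (eq_prob _ E) prob_cylinder; last exact: bit_wt_sum1.
rewrite /gnp_pmf.
rewrite [LHS](eq_bigl (fun z : bool * {set 'I_n} => true && (#|z.2| == 2%N)));
  last by move=> z; rewrite inE.
by rewrite -(pair_big xpredT (fun e : {set 'I_n} => #|e| == 2%N)
   (fun c e => wt (c, e) (y (c, e)))) /= big_bool.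
Qed.

Lemma prob_side_graphs_sum (Q : sgraph 'I_n -> sgraph 'I_n -> bool) :
  prob wt (fun x => Q (side_graph x true) (side_graph x false)) =
  \sum_(u : sgraph 'I_n * sgraph 'I_n | Q u.1 u.2) gnp_pmf p u.1 * gnp_pmf q u.2.
Proof.
under eq_bigr do rewrite -prob_side_graphs.
rewrite /prob -expect_sum; apply: eq_bigr => x _; congr (_ * _).
rewrite big_mkcond (bigD1 (side_graph x true, side_graph x false)) //= !eqxx big1 ?addr0.
  by case: (Q _ _).
move=> [g h]; rewrite xpair_eqE [g == _]eq_sym [h == _]eq_sym => /negPf /= ->.
by case: ifP.
Qed.

Lemma matched_side_graphs m (x : {ffun bool * {set 'I_n} -> bool}) :
  matched 'I_m x = `[< m_isomorphic m (side_graph x true) (side_graph x false) >].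
Proof.
apply/idP/asboolP => [/exists_inP[[a b]]|/m_isomorphicP[a [b [aI bI ab]]]].
  rewrite inE /= => /andP[/injectiveP aI /injectiveP bI] /forall_inP ev.
  apply/m_isomorphicP; exists a, b; split=> // d d2.
  rewrite !inE !card_imset //; move: (d2); rewrite inE => -> /=.
  exact/eqP/ev.
apply/exists_inP; exists (a, b); first by rewrite inE; apply/andP; split; apply/injectiveP.
apply/forall_inP => d d2; have := ab d d2.
rewrite !inE !card_imset //; move: d2; rewrite inE => -> /= ->; exact: eqxx.
Qed.

(** The event is a finite disjoint union of events [X = g], [Y = h], each of which has the same
    probability in the bit model. *)
Lemma prob_m_isomorphic d (T : measurableType d) (P : probability T R)
    (X Y : T -> sgraph 'I_n) (m : nat) :
    has_law_gnp P p X -> has_law_gnp P q Y -> independent_graphs P X Y ->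
  P [set w | m_isomorphic m (X w) (Y w)] = (prob wt (@matched 'I_m 'I_n))%:E.
Proof.
move=> [Xm Xp] [Ym Yp] XY.
have -> : prob wt (@matched 'I_m 'I_n) = prob wt (fun x =>
    `[< m_isomorphic m (side_graph x true) (side_graph x false) >]).
  by apply: eq_prob => x; exact: matched_side_graphs.
rewrite (prob_side_graphs_sum (fun g h => `[< m_isomorphic m g h >])).
pose F (u : sgraph 'I_n * sgraph 'I_n) := X @^-1` [set u.1] `&` Y @^-1` [set u.2].
pose r := [seq u <- index_enum _ | `[< m_isomorphic m u.1 u.2 >]]
  : seq (sgraph 'I_n * sgraph 'I_n).
have -> : [set w | m_isomorphic m (X w) (Y w)] = \bigcup_(u in [set` r]) F u.
  apply/seteqP; split=> [w iso|w [u /= + [Xu Yu]]].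
    exists (X w, Y w); last by split.
    by rewrite /= mem_filter mem_index_enum andbT; apply/asboolP.
  by rewrite mem_filter => /andP[/asboolP + _]; rewrite -Xu -Yu.
rewrite measure_fin_bigcup; last 3 first.
- exact: finite_seq.
- move=> [g h] [g' h'] _ _ [w [[gE hE] [g'E h'E]]].
  by move: gE hE g'E h'E => /= <- <- <- <-.
- by move=> u _; apply: measurableI; [exact: Xm | exact: Ym].
rewrite -fsbig_seq; last by rewrite filter_uniq // index_enum_uniq.
rewrite big_filter -sumEFin; apply: eq_bigr => u _.
transitivity (P (X @^-1` [set u.1]) * P (Y @^-1` [set u.2]))%E; first exact: XY.
by rewrite Xp Yp.
Qed.

End Coding.

(** * The threshold *)

Section Gap.
Variable R : realType.

Lemma two_powers_le (a b x y M : R) (i : nat) : 0 <= a -> 0 <= b -> 0 <= x -> 0 <= y ->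
  a <= M -> b <= M -> a ^+ i * x + b ^+ i * y <= M ^+ i * (x + y).
Proof.
move=> a0 b0 x0 y0 aM bM; rewrite mulrDr.
have M0 := le_trans a0 aM.
by apply: lerD; apply: ler_wpM2r => //; apply: lerXn2r.
Qed.

Variables (p q r s : R).
Hypotheses (p01 : 0 < p < 1) (q01 : 0 < q < 1) (r0 : 0 < r) (s0 : 0 < s) (s1 : s <= 1).
Hypothesis rE : p * q + (1 - p) * (1 - q) = r ^+ 2.
Hypothesis Hpq : p * q <= r ^+ 2 * s ^+ 4.
Hypothesis Hpq' : (1 - p) * (1 - q) <= r ^+ 2 * s ^+ 4.
Hypothesis H12 : p * q ^+ 2 + (1 - p) * (1 - q) ^+ 2 <= r ^+ 3 * s ^+ 4.
Hypothesis H21 : p ^+ 2 * q + (1 - p) ^+ 2 * (1 - q) <= r ^+ 3 * s ^+ 4.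

Let pow_s (i j : nat) : (i <= j)%N -> s ^+ j <= s ^+ i.
Proof. by move=> ij; apply: ler_wiXn2l => //; exact: ltW. Qed.

(** Powers of [p * q] and [(1 - p) * (1 - q)], both at most [r ^+ 2 * s ^+ 4], are pulled out until
    tau_{1,1}, tau_{1,2} or tau_{2,1} is left. The exponent 4 is dictated by [j = k = 2], where one
    such factor has to supply all of [s ^+ 4]. *)
Lemma path_weight_le (j k : nat) :
  (j <= k.+1)%N -> (k <= j.+1)%N -> (2 < j + k)%N ->
  p ^+ j * q ^+ k + (1 - p) ^+ j * (1 - q) ^+ k <= (r * s) ^+ (j + k).
Proof.
move/andP: p01 => [p0 p1]; move/andP: q01 => [q0 q1].
have p'0 : 0 <= 1 - p by rewrite subr_ge0 ltW.
have q'0 : 0 <= 1 - q by rewrite subr_ge0 ltW.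
have a0 : 0 <= p * q by rewrite mulr_ge0 ?ltW.
have b0 : 0 <= (1 - p) * (1 - q) by rewrite mulr_ge0.
have rs0 : 0 <= r ^+ 2 * s ^+ 4 by rewrite mulr_ge0 ?exprn_ge0 ?ltW.
move=> jk kj jk3.
have [/eqP E|[/eqP E|/eqP E]] : j == k \/ (k == j.+1 \/ j == k.+1).
  by move: jk kj; clear; lia.
- have [i Ei] : exists i, j = i.+2.
    by exists (j - 2)%N; move: E jk3; clear; lia.
  rewrite -E Ei; apply: (@le_trans _ _ ((r ^+ 2 * s ^+ 4) ^+ i.+1 * r ^+ 2)).
    apply: le_trans _ (_ : (r ^+ 2 * s ^+ 4) ^+ i.+1 * (p * q + (1 - p) * (1 - q)) <= _);
      last by rewrite rE.
    apply: le_trans _ (two_powers_le i.+1 a0 b0 a0 b0 Hpq Hpq').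
    by rewrite -!exprSr !exprMn.
  have -> : (r ^+ 2 * s ^+ 4) ^+ i.+1 * r ^+ 2 = r ^+ (i.+2 + i.+2) * s ^+ (4 * i.+1).
    rewrite exprMn -!exprM mulrAC -exprD; congr (r ^+ _ * _); clear; lia.
  rewrite exprMn; apply: ler_wpM2l; first by rewrite exprn_ge0 // ltW.
  by apply: pow_s; clear; lia.
- have [i Ei] : exists i, j = i.+1.
    by exists (j - 1)%N; move: E jk3; clear; lia.
  rewrite E Ei; apply: (@le_trans _ _ ((r ^+ 2 * s ^+ 4) ^+ i * (r ^+ 3 * s ^+ 4))).
    apply: le_trans _ (ler_wpM2l (exprn_ge0 i rs0) H12).
    apply: le_trans _ (two_powers_le i a0 b0 _ _ Hpq Hpq').
    - by rewrite le_eqVlt; apply/orP; left; apply/eqP; rewrite !exprMn !exprS; ring.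
    - by rewrite mulr_ge0 ?sqr_ge0 ?ltW.
    - by rewrite mulr_ge0 ?sqr_ge0.
  have -> : (r ^+ 2 * s ^+ 4) ^+ i * (r ^+ 3 * s ^+ 4) = r ^+ (i.+1 + i.+2) * s ^+ (4 * i + 4).
    rewrite exprMn -!exprM exprD mulrACA -!exprD; congr (r ^+ _ * s ^+ _); clear; lia.
  rewrite exprMn; apply: ler_wpM2l; first by rewrite exprn_ge0 // ltW.
  by apply: pow_s; clear; lia.
- have [i Ei] : exists i, k = i.+1.
    by exists (k - 1)%N; move: E jk3; clear; lia.
  rewrite E Ei; apply: (@le_trans _ _ ((r ^+ 2 * s ^+ 4) ^+ i * (r ^+ 3 * s ^+ 4))).
    apply: le_trans _ (ler_wpM2l (exprn_ge0 i rs0) H21).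
    apply: le_trans _ (two_powers_le i a0 b0 _ _ Hpq Hpq').
    - by rewrite le_eqVlt; apply/orP; left; apply/eqP; rewrite !exprMn !exprS; ring.
    - by rewrite mulr_ge0 ?sqr_ge0 ?ltW.
    - by rewrite mulr_ge0 ?sqr_ge0.
  have -> : (r ^+ 2 * s ^+ 4) ^+ i * (r ^+ 3 * s ^+ 4) = r ^+ (i.+2 + i.+1) * s ^+ (4 * i + 4).
    rewrite exprMn -!exprM exprD mulrACA -!exprD; congr (r ^+ _ * s ^+ _); clear; lia.
  rewrite exprMn; apply: ler_wpM2l; first by rewrite exprn_ge0 // ltW.
  by apply: pow_s; clear; lia.
Qed.

End Gap.

Section RegionY.
Variables (R : realType) (p q : R).
Hypothesis hpq : regionY (p, q).

Let K := - ln (tau p q).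

Lemma gap_exists : exists dl : R, [/\ 0 < dl, dl <= 1 & forall j k : nat,
  (j <= k.+1)%N -> (k <= j.+1)%N -> (2 < j + k)%N ->
  p ^+ j * q ^+ k + (1 - p) ^+ j * (1 - q) ^+ k <=
  (expR (- (K / 2)) * expR (- (dl * K / 2))) ^+ (j + k)].
Proof.
have [/= p01 q01 hmax] := hpq.
have K0 : 0 < K := rate_gt0 p01 q01.
have t0 := tau_gt0 p01 q01.
have tE : p * q + (1 - p) * (1 - q) = tau p q by rewrite /tau /tau_ !expr1.
move/andP: (p01) => [p0 p1]; move/andP: (q01) => [q0 q1].
have p'0 : 0 < 1 - p by rewrite subr_gt0.
have q'0 : 0 < 1 - q by rewrite subr_gt0.
set r := expR (- (K / 2)); have r0 : 0 < r := expR_gt0 _.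
have rE : tau p q = r ^+ 2.
  by rewrite (tau_exp p01 q01) -expRM_natr; congr expR; rewrite -/K; field.
have r3 : tau p q `^ (3 / 2) = r ^+ 3.
  by rewrite /powR gt_eqF // -expRM_natr; congr expR; rewrite /K; field.
rewrite r3 gt_max in hmax; have /andP[h12 h21] := hmax.
have r30 : 0 < r ^+ 3 by rewrite exprn_gt0.
(* The four ratios that [s ^+ 4] must dominate: the first two are below 1 because both summands of
   [tau] are positive, the last two by the choice of region. *)
pose mu := Num.max (Num.max (p * q / tau p q) ((1 - p) * (1 - q) / tau p q))
  (Num.max (tau_ 1 2 p q / r ^+ 3) (tau_ 2 1 p q / r ^+ 3)).
have pq0 : 0 < p * q by rewrite mulr_gt0.
have pq'0 : 0 < (1 - p) * (1 - q) by rewrite mulr_gt0.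
have mu0 : 0 < mu by rewrite /mu !lt_max divr_gt0.
have mu1 : mu < 1.
  rewrite /mu !gt_max !ltr_pdivrMr // !mul1r h12 h21 -tE ltrDl ltrDr pq0 pq'0.
  by [].
(* This makes [s ^+ 4 = expR (- (2 * dl * K))] at least [mu]; the cap 1 later ensures [u >= 1]. *)
pose dl := Num.min 1 (- ln mu / (2 * K)).
have lmu : 0 < - ln mu by rewrite oppr_gt0 ln_lt0 // mu0 mu1.
exists dl; split.
- by rewrite /dl lt_min ltr01 divr_gt0 // mulr_gt0.
- by rewrite /dl ge_min lexx.
set s := expR (- (dl * K / 2)).
have s0 : 0 < s := expR_gt0 _.
have dl0 : 0 < dl by rewrite /dl lt_min ltr01 divr_gt0 // mulr_gt0.
have s1 : s <= 1.
  by rewrite /s -expR0 ler_expR oppr_le0 divr_ge0 // mulr_ge0 // ltW.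
have s4 : mu <= s ^+ 4.
  rewrite -(lnK (x := mu)) ?posrE // -expRM_natr ler_expR.
  have : dl <= - ln mu / (2 * K) by rewrite /dl ge_min lexx orbT.
  rewrite ler_pdivlMr ?mulr_gt0 //; lra.
have [[b1 b2] [b3 b4]] :
   (p * q / tau p q <= s ^+ 4 /\ (1 - p) * (1 - q) / tau p q <= s ^+ 4) /\
   (tau_ 1 2 p q / r ^+ 3 <= s ^+ 4 /\ tau_ 2 1 p q / r ^+ 3 <= s ^+ 4).
  by move: s4; rewrite /mu !ge_max => /andP[/andP[-> ->] /andP[-> ->]].
apply: (path_weight_le p01 q01 r0 s0 s1).
- by rewrite tE rE.
- by rewrite -rE -ler_pdivrMl // mulrC.
- by rewrite -rE -ler_pdivrMl // mulrC.
- by rewrite -ler_pdivrMl // mulrC; move: b3; rewrite /tau_ !expr1.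
- by rewrite -ler_pdivrMl // mulrC; move: b4; rewrite /tau_ !expr1.
Qed.

End RegionY.

Lemma window_arith (R : realFieldType) (la L D B x t s : R) : 0 < la ->
    4 * la * L + 2 * la + 1 <= 2 * x + 2 * la * t + 2 * la * s ->
    D + B <= L * la -> la * (t + s) <= D ->
  la * L + B <= x.
Proof. lra. Qed.

(** * Matching probabilities above and below the window *)

Section Threshold.
Variables (R : realType) (p q : R).
Hypothesis hpq : regionY (p, q).

Let K := - ln (tau p q).
Let la := lambda p q.

Definition prob_matched (m n : nat) : R :=
  prob (bit_wt (@fst bool {set 'I_n}) p q) (@matched 'I_m 'I_n).

Let p01 : 0 < p < 1. Proof. by case: hpq. Qed.
Let q01 : 0 < q < 1. Proof. by case: hpq. Qed.
Let K0 : 0 < K. Proof. exact: rate_gt0. Qed.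
Let laK : la * K = 1. Proof. by rewrite /la lambdaE // mulVf // gt_eqF. Qed.
Let la0 : 0 < la. Proof. by rewrite /la lambdaE // invr_gt0. Qed.
Let pi2 : 2 <= pi :> R. Proof. exact: pi_ge2. Qed.

Let lapi : 0 <= 4 * la * pi.
Proof.
apply: mulr_ge0; last by apply: le_trans pi2.
by apply: mulr_ge0 => //; exact: ltW.
Qed.

Let tau_sqr : p * q + (1 - p) * (1 - q) = expR (- (K / 2)) ^+ 2.
Proof.
rewrite -expRM_natr -[LHS](_ : tau p q = _); last by rewrite /tau /tau_ !expr1.
by rewrite (tau_exp p01 q01); congr expR; rewrite -/K; field.
Qed.

Let ln2pi0 : 0 <= ln (2 * pi) :> R.
Proof. by apply: ln_ge0; have := pi2; lra. Qed.

Let ln_gt0_nat (n : nat) : 0 < ln n%:R :> R -> (0 < n)%N.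
Proof. by case: n => //; rewrite ln0 ?ltxx. Qed.

Lemma prob_matched_ge0 m n : 0 <= prob_matched m n.
Proof. by apply: prob_ge0; exact: bit_wt_ge0. Qed.

Lemma prob_matched_le1 m n : prob_matched m n <= 1.
Proof.
rewrite -subr_ge0 -probC; last exact: bit_wt_sum1.
by apply: prob_ge0; exact: bit_wt_ge0.
Qed.

Lemma prob_matched_le_inv (m n : nat) : (0 < m)%N -> (0 < n)%N ->
  prob_matched m n <=
  ((m`!)%:R * expR (- K) ^- 'C(m, 2) / n%:R ^+ (2 * m))^-1.
Proof.
move=> m0 n0; apply: le_trans (prob_matched_le 'I_m 'I_n p01 q01 tau_sqr) _.
rewrite !card_ord -tau_sqr.
have -> : p * q + (1 - p) * (1 - q) = expR (- K).
  by rewrite -(tau_exp p01 q01) /tau /tau_ !expr1.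
rewrite !invfM !invrK.
have f0 : 0 < (m`!)%:R :> R by rewrite ltr0n fact_gt0.
have -> : (m`!)%:R^-1 * expR (- K) ^+ 'C(m, 2) * n%:R ^+ (2 * m) =
  (n%:R ^+ m) ^+ 2 * expR (- K) ^+ 'C(m, 2) / (m`!)%:R.
  by rewrite mulnC exprM; ring.
rewrite ler_wpM2r ?invr_ge0 // ler_wpM2r ?exprn_ge0 ?expR_ge0 //.
apply: lerXn2r; rewrite ?nnegrE ?exprn_ge0 //.
by rewrite -natrX ler_nat ffact_leX.
Qed.

Let D := `|la * (ln (2 * la) + pi)|.

Let D0 : 0 <= D. Proof. exact: normr_ge0. Qed.

Lemma m_star_large (B : R) (n : nat) : 0 <= B ->
    pi + (D + B) / la <= ln n%:R ->
  [/\ 1 <= m_star p q n,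
      Wfun p q (m_star p q n) = 4 * la * ln n%:R + 2 * la + 1 &
      la * ln n%:R + B <= m_star p q n].
Proof.
move=> B0 hL; set L := ln n%:R in hL *.
have DB : 0 <= D + B by exact: addr_ge0.
have h1 : (D + B) / la <= L by apply: le_trans hL; rewrite lerDr; have := pi2; lra.
have h2 : pi <= L by apply: le_trans hL; rewrite lerDl divr_ge0 // ltW.
have h3 : pi <= 2 * L by have := pi2; lra.
have [x1 xE] := m_starP p01 q01 h3; split=> //.
have lin := window_linear p01 q01 x1 xE; rewrite -/la -/L in lin.
rewrite ler_pdivrMr // in h1.
have hD : la * (ln (2 * la) + pi) <= D by exact: ler_norm.
exact: window_arith la0 lin h1 hD.
Qed.

(** Since [m * K >= L], a displacement [c] from [m_star] moves the exponent of the first moment by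
    at least [c * L / 4]. This explains the width [C n / log n] of the window: the shift is at least
    [C n / 4]. *)
Let first_moment_gain (m : nat) (L c d : R) : 0 <= c -> 0 <= L -> la * L <= m%:R ->
  c / 2 <= d -> c * L / 4 <= m%:R * K / 2 * d.
Proof.
move=> c0 L0 hm hd.
have mK : L <= m%:R * K.
  by have := ler_wpM2r (ltW K0) hm; rewrite mulrAC laK mul1r.
have -> : c * L / 4 = (L / 2) * (c / 2) by field.
by apply: ler_pM; rewrite ?divr_ge0 // ler_pM2r.
Qed.

Lemma above_window (e : R) : 0 < e -> exists L0 C0 : R, forall (m n : nat) (c : R),
    L0 <= ln n%:R -> 0 <= c -> C0 <= c * ln n%:R -> m_star p q n + c <= m%:R ->
  prob_matched m n <= e.
Proof.
move=> e0; pose B := 4 * la * pi + 1.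
have B0 : 0 <= B by rewrite addr_ge0.
(* The second constant makes [c * L / 4] exceed [ln (2 * pi) / 2 - ln e]; the Stirling error has the
   favourable sign. *)
exists (pi + (D + B) / la), (4 * (ln (2 * pi) / 2 - ln e)).
move=> m n c hL c0 hC hm.
have [x1 xE xL] := m_star_large B0 hL.
set L := ln n%:R in hL hC xE xL; set x := m_star p q n in hm x1 xE xL.
have L0 : 0 < L.
  apply: lt_le_trans hL; apply: ltr_wpDr; last by apply: lt_le_trans pi2.
  by apply: divr_ge0; [exact: addr_ge0 | exact: ltW].
have n0 := ln_gt0_nat L0.
have laL : 0 <= la * L by apply: mulr_ge0; apply: ltW.
have xm : x <= m%:R by apply: le_trans hm; rewrite lerDl.
have m0 : (0 < m)%N by rewrite -(ltr0n R) (lt_le_trans _ xm) // (lt_le_trans _ x1).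
have lm : la * L <= m%:R by apply: le_trans xm; apply: le_trans xL; rewrite lerDl.
have mpi : 4 * la * pi <= m%:R.
  by apply: le_trans xm; apply: le_trans xL; rewrite /B; lra.
have dW := Wfun_diff p01 q01 x1 xm mpi.
have cW : c / 2 <= Wfun p q m%:R - Wfun p q x by apply: le_trans dW; lra.
have G := first_moment_gain c0 (ltW L0) lm cW.
apply: le_trans (prob_matched_le_inv m0 n0) _.
rewrite (first_moment_exponent p01 q01 m0 n0 xE) -expRN -[leRHS](lnK (x := e)) ?posrE //.
rewrite ler_expR; have /andP[S _] := stirling_bound R m0.
by move: G S hC; set g := _ * (_ - _); lra.
Qed.

Lemma below_window (e : R) : 0 < e -> exists L0 C0 : R, forall (m n : nat) (c : R),
    L0 <= ln n%:R -> 0 <= c -> c <= 1 -> C0 <= c * ln n%:R ->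
    m%:R <= m_star p q n - c -> m_star p q n - c < m%:R + 1 ->
  1 - prob_matched m n <= e.
Proof.
move=> e0; pose w := Num.min (1 / 4) (e / 20).
have w0 : 0 < w by rewrite /w lt_min !divr_gt0.
have w1 : w <= 1 / 4 by rewrite /w ge_min lexx.
have we : 20 * w <= e by rewrite mulrC -ler_pdivlMr // /w ge_min lexx orbT.
have [dl [dl0 dl1 gap]] := gap_exists hpq; rewrite -/K in gap.
(* The first summand comes from the lower bound on [m_star], using [m_star <= m + 2] and
   [m_star <= 3 * m]; the second comes from the upper bound. *)
pose A := 3 * expR (pi + K) + expR (1 / 2 + K / 4).
have A1 : 1 <= A.
  have : 1 <= expR (1 / 2 + K / 4).
    by rewrite -expR0 ler_expR addr_ge0 // divr_ge0 // ltW.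
  by rewrite /A; have := expR_ge0 (pi + K); lra.
have [T HT] := second_moment_ratio K0 dl0 dl1 A1 w0 w1.
(* The term [4 * la * pi] serves [Wfun_diff]; [T + 3] gives [m >= T + 1], as [c] and rounding lower
   [m] by at most 2. *)
pose B := 4 * la * pi + T%:R + 3.
have B0 : 0 <= B by rewrite addr_ge0 // addr_ge0.
exists (pi + (D + B) / la), (4 * (1 - ln w)).
move=> m n c hL c0 c1 hC hm1 hm2.
have [x1 xE xL] := m_star_large B0 hL.
set L := ln n%:R in hL hC xE xL; set x := m_star p q n in hm1 hm2 x1 xE xL.
have L0 : 0 < L.
  apply: lt_le_trans hL; apply: ltr_wpDr; last by apply: lt_le_trans pi2.
  by apply: divr_ge0; [exact: addr_ge0 | exact: ltW].
have n0 := ln_gt0_nat L0.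
have nR : 0 < n%:R :> R by rewrite ltr0n.
have laL : 0 <= la * L by apply: mulr_ge0; apply: ltW.
have Tge0 : 0 <= T%:R :> R by [].
have mT : T%:R + 1 <= m%:R :> R by move: xL lapi; rewrite /B; lra.
have lm : la * L <= m%:R by move: xL lapi; rewrite /B; lra.
have mge1 : 1 <= m%:R :> R by lra.
have m0 : (0 < m)%N by rewrite -(ltr0n R); lra.
have Tm : (T <= m)%N by rewrite -(ler_nat R); lra.
have mx : m%:R <= x by lra.
have x3m : x <= 3 * m%:R by lra.
have xm2 : x <= m%:R + 2 by lra.
have xpi : 4 * la * pi <= x by move: xL lapi; rewrite /B; lra.
have nE : n%:R = expR L by rewrite /L lnK.
have H2 : expR (K * m%:R / 4) <= A * n%:R.
  apply: (@le_trans _ _ (expR (1 / 2 + K / 4) * n%:R)); last first.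
    by rewrite ler_wpM2r // /A lerDr mulr_ge0 ?expR_ge0.
  rewrite nE -expRD ler_expR.
  have up := window_upper p01 q01 x1 xE.
  have : K * m%:R <= K * (4 * la * L + 2 * la + 1).
    by rewrite ler_pM2l // (le_trans mx).
  have -> : K * (4 * la * L + 2 * la + 1) = la * K * (4 * L + 2) + K by ring.
  by rewrite laK; lra.
have H1 : n%:R ^+ 2 <= A * m%:R * expR (K * m%:R / 2).
  apply: (@le_trans _ _ (3 * expR (pi + K) * m%:R * expR (K * m%:R / 2))); last first.
    by rewrite ler_wpM2r ?expR_ge0 // ler_wpM2r // /A lerDl expR_ge0.
  have x0 : 0 < x by lra.
  apply: (@le_trans _ _ (expR pi * x * expR (K * x / 2))).
    rewrite nE -expRM_natr -{1}(lnK (x := x)) ?posrE // -!expRD ler_expR.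
    have := ler_wpM2l (ltW K0) (window_lower p01 q01 x1 xE); rewrite -/la.
    have -> : K * (4 * la * L + 2 * la + 1) = la * K * (4 * L + 2) + K by ring.
    have -> : K * (x + 2 * la * ln x + 2 * la * pi) =
      K * x + la * K * (2 * ln x + 2 * pi) by ring.
    by rewrite laK; have := K0; lra.
  have -> : 3 * expR (pi + K) * m%:R * expR (K * m%:R / 2) =
    expR pi * (3 * m%:R) * expR (K * (m%:R + 2) / 2).
    rewrite (_ : K * (m%:R + 2) / 2 = K + K * m%:R / 2); last by field.
    by rewrite !expRD; ring.
  apply: ler_pM; rewrite ?mulr_ge0 ?expR_ge0 ?(ltW x0) //.
    by rewrite ler_wpM2l ?expR_ge0.
  by rewrite ler_expR ler_pM2r // ler_pM2l.
have HE : (m`!)%:R * expR (- K) ^- 'C(m, 2) / n%:R ^+ (2 * m) <= w.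
  rewrite (first_moment_exponent p01 q01 m0 n0 xE) -[leRHS](lnK (x := w)) ?posrE //.
  rewrite ler_expR; have /andP[_ S] := stirling_bound R m0.
  have dW := Wfun_diff p01 q01 mge1 mx xpi.
  have cW : c / 2 <= Wfun p q x - Wfun p q m%:R by apply: le_trans dW; lra.
  have G := first_moment_gain c0 (ltW L0) lm cW.
  have -> : m%:R * K / 2 * (Wfun p q m%:R - Wfun p q x) =
    - (m%:R * K / 2 * (Wfun p q x - Wfun p q m%:R)) by ring.
  by move: G S hC ln2pi0; set g := _ * (_ - _); lra.
have [mn HS] := HT m n Tm n0 H2 H1 HE.
apply: le_trans we; apply: le_trans HS.
have rho1 : expR (- (dl * K / 2)) <= 1.
  by rewrite -expR0 ler_expR oppr_le0 divr_ge0 // mulr_ge0 // ltW.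
have r1 : expR (- (K / 2)) <= 1 by rewrite -expR0 ler_expR oppr_le0 divr_ge0 // ltW.
have u1 : 1 <= expR ((1 - dl) * K / 4).
  rewrite -[leLHS]expR0 ler_expR; apply: divr_ge0 => //; apply: mulr_ge0; last exact: ltW.
  by rewrite subr_ge0.
have uE : expR ((1 - dl) * K / 4) ^+ 2 * expR (- (K / 2)) = expR (- (dl * K / 2)).
  by rewrite -expRM_natr -expRD; congr expR; field.
have cmn : (#|'I_m| <= #|'I_n|)%N by rewrite !card_ord.
have := prob_unmatched_le p01 q01 (expR_gt0 _) r1 (expR_gt0 _) rho1 tau_sqr gap u1 uE cmn.
have -> : expR (- (K / 2)) ^+ 2 = expR (- K).
  by rewrite -tau_sqr -(tau_exp p01 q01) /tau /tau_ !expr1.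
by rewrite !card_ord.
Qed.

End Threshold.

Theorem theorem2p6 (R : realType) (p q : R) (hpq : regionY (p, q))
    (d : nat -> measure_display) (T : forall n : nat, measurableType (d n))
    (P : forall n : nat, probability (T n) R)
    (X Y : forall n : nat, T n -> sgraph 'I_n)
    (hX : forall n : nat, has_law_gnp (P n) p (X n))
    (hY : forall n : nat, has_law_gnp (P n) q (Y n))
    (hXY : forall n : nat, independent_graphs (P n) (X n) (Y n))
    (C : nat -> R)
    (hC : C n @[n --> \oo] --> +oo)
    (hClog : C n / ln n%:R @[n --> \oo] --> (0 : R)) :
  (forall m : nat -> nat,
     (\forall n \near \oo,
        (m n)%:Z = Num.floor (m_star p q n - C n / ln n%:R)) ->
     P n [set w | m_isomorphic (m n) (X n w) (Y n w)] @[n --> \oo] --> 1%E) /\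
  (forall m : nat -> nat,
     (\forall n \near \oo,
        (m n)%:Z = Num.ceil (m_star p q n + C n / ln n%:R)) ->
     P n [set w | m_isomorphic (m n) (X n w) (Y n w)] @[n --> \oo] --> 0%E).
Proof.
have [/= p01 q01 _] := hpq.
have PE m : (fun n => P n [set w | m_isomorphic (m n) (X n w) (Y n w)]) =
    EFin \o (fun n => prob_matched p q (m n) n).
  by apply/funext => n; rewrite (prob_m_isomorphic (m n) (hX n) (hY n) (hXY n)).
have lnoo (A : R) : \forall n \near \oo, A <= ln n%:R.
  exists (Num.trunc (expR A)).+1 => // n /= hn.
  rewrite -[A]expRK ler_ln ?posrE ?expR_gt0 //; last by rewrite ltr0n (leq_trans _ hn).
  by rewrite ltW // (lt_le_trans (truncnS_gt _)) // ler_nat.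
have Coo (A : R) : \forall n \near \oo, A <= C n by move/cvgryPge: hC; apply.
(* The convergence of [C n / log n] to 0 enters as the bound 1, which keeps the rounded-down [m n]
   within 2 of [m_star]. *)
have c1 : \forall n \near \oo, C n / ln n%:R <= 1.
  move/cvgrPdist_le: hClog => /(_ 1 ltr01); apply: filterS => n.
  by rewrite sub0r normrN => /(le_trans (ler_norm _)).
have cE n : 1 <= ln n%:R :> R -> C n / ln n%:R * ln n%:R = C n.
  by move=> l1; rewrite divfK // gt_eqF // (lt_le_trans _ l1).
split=> m hm; rewrite PE; apply: cvg_EFin => /=; try exact: nearW.
- apply/cvgrPdist_le => e e0.
  have [L0 [C0 H]] := below_window hpq e0.
  near=> n.
  have l1 : 1 <= ln n%:R :> R by near: n; exact: lnoo.
  have Cn : 0 <= C n by near: n; exact: Coo.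
  have mE : (m n)%:Z = Num.floor (m_star p q n - C n / ln n%:R) by near: n.
  have mR : (m n)%:R = (Num.floor (m_star p q n - C n / ln n%:R))%:~R :> R by rewrite -mE.
  rewrite ger0_norm ?subr_ge0 ?prob_matched_le1 //.
  apply: (H (m n) n (C n / ln n%:R)).
  + by near: n; exact: lnoo.
  + by rewrite divr_ge0 // (le_trans _ l1).
  + by near: n.
  + by rewrite cE //; near: n; exact: Coo.
  + by rewrite mR; exact: floor_le_tmp.
  + by rewrite mR; have := floorD1_gt (m_star p q n - C n / ln n%:R); rewrite intrD.
- apply/cvgrPdist_le => e e0.
  have [L0 [C0 H]] := above_window hpq e0.
  near=> n.
  have l1 : 1 <= ln n%:R :> R by near: n; exact: lnoo.
  have Cn : 0 <= C n by near: n; exact: Coo.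
  have mE : (m n)%:Z = Num.ceil (m_star p q n + C n / ln n%:R) by near: n.
  have mR : (m n)%:R = (Num.ceil (m_star p q n + C n / ln n%:R))%:~R :> R by rewrite -mE.
  rewrite sub0r normrN ger0_norm ?prob_matched_ge0 //.
  apply: (H (m n) n (C n / ln n%:R)).
  + by near: n; exact: lnoo.
  + by rewrite divr_ge0 // (le_trans _ l1).
  + by rewrite cE //; near: n; exact: Coo.
  + by rewrite mR; exact: ceil_ge.
Unshelve. all: end_near. Qed.
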